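(* Let $k$ and $n$ be positive integers with $k\leq n^2$. Let $m$ be the smallest positive integer such that $G(m)\geq k$, where $$ G(m) = \begin{cases}\left\lfloor\frac{m^2}{12}\right\rfloor+1 & \text{if } m\equiv 3,6,9\pmod{12}, \text{ or if } m=10,\\[2mm] \left\lfloor\frac{m^2}{12}\right\rfloor & \text{otherwise}. \end{cases} $$ Then, among all placements of $k$ queens on distinct squares of an $n\times n$ chessboard, the minimum possible number of squares attacked by these queens is $mn+O(k)$, where the implied constant in $O(k)$ is absolute (independent of $k$, $n$ and $m$).
   Context: A queen on a square attacks every square lying on the same row, the same column, or either of the two diagonals (lines of slope $+1$ and $-1$) through its square; blocking by other pieces is ignored, so the set of squares attacked by a collection of queens is the union of the rows, columns and diagonals passing through the queens' squares. *)

(* Defs.v *)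
From mathcomp Require Import all_boot all_order all_algebra.

Set Implicit Arguments.
Unset Strict Implicit.
Unset Printing Implicit Defensive.

(* A queen attacks her own square as well.  The equations of the two diagonals,
   s.1 - q.1 = s.2 - q.2 and s.1 - q.1 = q.2 - s.2 in the integers, are written
   without subtraction. *)
Definition attacks (n : nat) (q s : 'I_n * 'I_n) : bool :=
  [|| s.1 == q.1,
      s.2 == q.2,
      (s.1 + q.2 == q.1 + s.2)%N
    | (s.1 + s.2 == q.1 + q.2)%N].

Definition attacked (n : nat) (Q : {set 'I_n * 'I_n}) : {set 'I_n * 'I_n} :=
  [set s | [exists q in Q, attacks q s]].

(* The starting value n ^ 2 of the iterated minimum is an upper bound of every
   term, so this is the true minimum as soon as some placement of k queens
   exists, that is, for k <= n ^ 2. *)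
Definition min_attacked (n k : nat) : nat :=
  \big[minn/n ^ 2]_(Q : {set 'I_n * 'I_n} | #|Q| == k) #|attacked Q|.

Definition G (m : nat) : nat :=
  if (m %% 12 \in [:: 3; 6; 9]) || (m == 10)
  then (m ^ 2 %/ 12).+1
  else m ^ 2 %/ 12.

(* Main.v *)
(** The two diagonals of a queen have total length greater than [n].  So for each
    [t < n] every queen lies on a diagonal longer than [t] or on an antidiagonal
    longer than [n - t]; let [e t] be the number of these lines.  The sum of [e t]
    over [t] is at most the total length of the diagonals.

    Fix [t] and let the queens occupy [a] rows and [b] columns.  Peel off
    concentric frames (extreme rows and columns): a line meets a frame at most
    twice, so [k <= 2 e T + (a - 2 T) (b - 2 T)] for all [T], which implies
    [k <= G (a + b + e)] except for four families of [(a, b, e)] where the bound is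
    larger by one.  In two of them the innermost full block would have to be an
    oblong and a square at once.  In the other two it is a square whose columns and
    rows have mean gap at most the width of the next frame, and then its diagonals
    are long enough to pay for one more line.  Thus rows, columns and O(m) diagonals
    have total length at least [m n], and they overlap in O(m^2) = O(k) squares.

    Conversely, a hexagon of queens in a corner attacks along rows, columns and
    one family of long diagonals only.  If [m] is 6 mod 12, four hexagons, one in each
    corner, are better by one queen, and for [m = 10] so is a 3 x 3 grid spread over
    the whole board. *)
Require Import Defs.
From mathcomp Require Import all_boot all_order all_algebra.
From mathcomp Require Import zify ring.

Set Implicit Arguments.
Unset Strict Implicit.
Unset Printing Implicit Defensive.

Import Order.TTheory GRing.Theory Num.Theory.

(** * The function G and the arithmetic of the frame bound *)

Lemma G_bound (m : nat) : m ^ 2 %/ 12 <= G m <= (m ^ 2 %/ 12).+1.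
Proof. by rewrite /G; case: ifP => _; rewrite !leqnn leqnSn. Qed.

(** As [(12 q + r)^2 = 12 (12 q^2 + 2 q r) + r^2], only [r^2] is rounded: for a fixed residue, [G]
    is a polynomial in [q] apart from the exception [m = 10]. *)
Lemma GE (q r : nat) : r < 12 ->
  G (12 * q + r) = 12 * q ^ 2 + 2 * q * r + r ^ 2 %/ 12
    + ((r \in [:: 3; 6; 9]) || (12 * q + r == 10)).
Proof.
move=> r12; rewrite /G -(mulnC q 12) modnMDl modn_small //.
have -> : (q * 12 + r) ^ 2 = (12 * q ^ 2 + 2 * q * r) * 12 + r ^ 2.
  by rewrite !expnS !expn0; lia.
by rewrite divnMDl //; case: ifP => _; rewrite ?addn1 ?addn0.
Qed.

(** Minimality gives [(m - 1)^2 < 12 k], and [m <= 2 (m - 1)] because [G 1 = 0]. This turns errors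
    of order [m^2] into errors of order [k]. *)
Lemma G_lower_sq (m k : nat) : 0 < k -> 0 < m -> k <= G m ->
  (forall m', 0 < m' -> k <= G m' -> m <= m') -> m ^ 2 <= 48 * k.
Proof.
case: m => // m k0 _ km min_m.
case: m km min_m => [|m] km min_m; first by rewrite /G /= in km; lia.
have : ~~ (k <= G m.+1) by apply/negP => /(min_m m.+1 isT); rewrite ltnn.
have /andP[h _] := G_bound m.+1.
rewrite -ltnNge => h2; have {h2}h : m.+1 ^ 2 %/ 12 < k by apply: leq_ltn_trans h2.
have h3 := divn_eq (m.+1 ^ 2) 12; have h4 := ltn_pmod (m.+1 ^ 2) (isT : 0 < 12).
have : m.+1 ^ 2 < 12 * k by lia.
by rewrite !expnS !expn0; nia.
Qed.

(* The triples for which the frame bound, with [T = q], exceeds [G (a + b + e)];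
   [T = q] and [T = q + 1] then give the same bound. *)
Definition exceptional (a b e k q : nat) : Prop :=
  [/\ k = 2 * e * q + (a - 2 * q) * (b - 2 * q) &
   [\/ [/\ 0 < q, a = 4 * q + 1, b = 4 * q + 1 & e = 4 * q],
       [/\ 0 < q, a + b = 8 * q + 3, 4 * q < a, 4 * q < b & e = 4 * q + 1],
       [/\ a + b = 8 * q + 5, 4 * q + 1 < a, 4 * q + 1 < b & e = 4 * q + 3] |
       [/\ 0 < q, a = 4 * q + 3, b = 4 * q + 3 & e = 4 * q + 4]]].

Lemma sq_small (z d c : int) : (z * z + 3 * (d * d) <= c -> c <= 4 ->
  -2 <= z <= 2 /\ -1 <= d <= 1)%R.
Proof. by move=> h1 h2; nia. Qed.

(** With [m = 12 Q + r = 2 h + x], the numbers [x] and [m] have the same parity. For [x = 0, 1, -1]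
    the bound [(m^2 + 3 x^2) / 12] rounds down to at most [G m]: an odd square is 1 or 9 mod 12, and
    9 only for [r = 3, 9], where [G] has the extra one. For [x = -2] it exceeds [m^2 / 12] by one,
    so [w] is at most the remainder of [m^2] mod 12, and the values where [G] has the extra one drop
    out. *)
Lemma frame_residue (Q r k h : nat) (x w : int) : r < 12 ->
  12 * Q ^ 2 + 2 * Q * r + r ^ 2 %/ 12
    + ((r \in [:: 3; 6; 9]) || (12 * Q + r == 10)) < k ->
  (r%:Z = 2 * h%:Z + x - 12 * Q%:Z)%R ->
  (x = 1 \/ x = 0 \/ x = -1 \/ x = -2)%R -> (0 <= w)%R ->
  (w + 12 * k%:Z <= 144 * (Q%:Z * Q%:Z) + 24 * (Q%:Z * r%:Z) + r%:Z * r%:Z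
     + 3 * (x * x))%R ->
  [/\ (w <= (if r == 0%N then 0 else 4))%R, x = (-2)%R & (r \in [:: 0; 2; 4; 8]) || ((r == 10) && (0 < Q))].
Proof.
move=> r12; have rE : r \in iota 0 12 by rewrite mem_iota.
have -> : 12 * Q ^ 2 = 12 * (Q * Q) by rewrite expnS expn1.
have -> : (Q%:Z * Q%:Z = (Q * Q)%:Z)%R by rewrite PoszM.
move: (Q * Q) => QQ hk hr hx w0 hw.
move: rE; rewrite !inE; do 11?[case/orP]; move/eqP=> rE;
  rewrite {}rE /= ?addn0 ?addn1 in hk hr hw *; clear r12;
  case: hx => [|[|[|]]] xE; rewrite {}xE in hr hw *; try (by exfalso; lia);
  split=> //; lia.
Qed.

(* With [m = a + b + e], [x = e - p1 - p2] and [z = p1 + p2 + 2 x - 4 T], the frame bound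
   [v = 2 e T + p1 p2] satisfies [12 v = m^2 - z^2 + 3 x^2 - 3 (p1 - p2)^2]. *)
Lemma frame_value (T p1 p2 e k : nat) : 0 < k ->
  k <= (p1 + 2 * T) * e -> k <= (p2 + 2 * T) * e ->
  e <= p1 + p2 + 1 -> p1 + p2 <= e + 2 -> k <= 2 * e * T + p1 * p2 ->
  G (p1 + 2 * T + (p2 + 2 * T) + e) < k ->
  exceptional (p1 + 2 * T) (p2 + 2 * T) e k T.
Proof.
move=> k0 k1 k2 he1 he2 kv.
have sq0 (y : int) : (0 <= y * y)%R by rewrite -expr2 sqr_ge0.
set m := p1 + _ + _ + e => hG.
have [x hx] : exists x : int, (x = e%:Z - p1%:Z - p2%:Z)%R by eexists.
have [z hz] : exists z : int, (z = p1%:Z + p2%:Z + 2 * x - 4 * T%:Z)%R by eexists.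
have [d hd] : exists d : int, (d = p1%:Z - p2%:Z)%R by eexists.
have key : (12 * (2 * e%:Z * T%:Z + p1%:Z * p2%:Z) + z * z + 3 * (d * d) =
   m%:Z * m%:Z + 3 * (x * x))%R.
  have -> : (e%:Z = p1%:Z + p2%:Z + x)%R by lia.
  have -> : (m%:Z = 2 * p1%:Z + 2 * p2%:Z + 4 * T%:Z + x)%R by rewrite /m; lia.
  by rewrite hz hd; ring.
have Em : m = 12 * (m %/ 12) + m %% 12 by rewrite mulnC; exact: divn_eq.
have hr : m %% 12 < 12 by rewrite ltn_pmod.
move: hG Em hr; set Q := m %/ 12; set r := m %% 12 => hG Em hr.
rewrite Em GE // in hG.
have key2 : (z * z + 3 * (d * d) + 12 * k%:Z <=
  144 * (Q%:Z * Q%:Z) + 24 * (Q%:Z * r%:Z) + r%:Z * r%:Z + 3 * (x * x))%R.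
  have -> : (144 * (Q%:Z * Q%:Z) + 24 * (Q%:Z * r%:Z) + r%:Z * r%:Z =
     m%:Z * m%:Z)%R by rewrite {1 2}Em PoszD PoszM; ring.
  by rewrite -key; lia.
have hm : (m%:Z = 2 * p1%:Z + 2 * p2%:Z + 4 * T%:Z + x)%R by rewrite /m; lia.
have hx' : (x = 1 \/ x = 0 \/ x = -1 \/ x = -2)%R by lia.
clear key.
have zz : (0 <= z * z + 3 * (d * d))%R by have := sq0 z; have := sq0 d; lia.
have [|w4 xE rin] := frame_residue (h := p1 + p2 + 2 * T) hr hG _ hx' zz key2.
  by lia.
have [|zb db] := @sq_small z d 4 _ isT; first by case: ifP w4 => _; lia.
have {}w4 : r = 0 -> (z * z + 3 * (d * d) <= 0)%R by move=> r0; move: w4; rewrite r0.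
have {}rin : r = 0 \/ r = 2 \/ r = 4 \/ r = 8 \/ r = 10 /\ 0 < Q.
  by move: rin; rewrite !inE; case/orP=> [/or4P[]|/andP[]] /eqP ->; tauto.
have zs : (z = -2 \/ z = -1 \/ z = 0 \/ z = 1 \/ z = 2)%R by lia.
have ds : (d = -1 \/ d = 0 \/ d = 1)%R by lia.
clear key2 zz hx' hr zb db.
rewrite xE in hx hz hm; rewrite /exceptional !addnK.
(* For [x = -2] one has [m = 12 T + 6 + 2 z] with [|z| <= 2], so [T] is the quotient by 12 and [z]
   fixes the residue; [z = 0] would give the excluded residue 6. *)
have QTr : [\/ [/\ Q = T, r = 2 & (z = -2)%R], [/\ Q = T, r = 4 & (z = -1)%R],
   [/\ Q = T, r = 8 & (z = 1)%R] | [/\ Q = T, r = 10 & (z = 2)%R]].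
  have mE : (m%:Z = 12 * T%:Z + 6 + 2 * z)%R by lia.
  have d0 := sq0 d; clear - Em mE rin w4 zs d0; clearbody Q r m.
  case: zs => [|[|[|[|]]]] zE; rewrite zE in mE w4 *;
    case: rin => [rE|[rE|[rE|[rE|[rE Q0]]]]]; rewrite rE in Em w4;
    try (by exfalso; move: (w4 erefl); lia); clear w4; try (by exfalso; lia);
    by [apply: Or41; split=> //; lia | apply: Or42; split=> //; lia
       | apply: Or43; split=> //; lia | apply: Or44; split=> //; lia].
clear rin w4 zs.
case: QTr => [] [QT rE zE]; rewrite {}zE {}QT {}rE /= in hz hG.
- have p1E : p1 = 2 * T + 1 by lia.
  have p2E : p2 = 2 * T + 1 by lia.
  have eE : e = 4 * T by lia.
  subst p1 p2 e; split; first by lia.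
  by apply: Or41; split; lia.
- have eE : e = 4 * T + 1 by lia.
  have pp : p1 * p2 = 4 * (T * T) + 6 * T + 2.
    by have [[-> ->]|[-> ->]] : (p1 = 2 * T + 1 /\ p2 = 2 * T + 2) \/ (p1 = 2 * T + 2 /\ p2 = 2 * T + 1); lia.
  rewrite pp eE in kv *; split; first by lia.
  by apply: Or42; split; lia.
- have eE : e = 4 * T + 3 by lia.
  have pp : p1 * p2 = 4 * (T * T) + 10 * T + 6.
    by have [[-> ->]|[-> ->]] : (p1 = 2 * T + 3 /\ p2 = 2 * T + 2) \/ (p1 = 2 * T + 2 /\ p2 = 2 * T + 3); lia.
  rewrite pp eE in kv *; split; first by lia.
  by apply: Or43; split; lia.
- have p1E : p1 = 2 * T + 3 by lia.
  have p2E : p2 = 2 * T + 3 by lia.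
  have eE : e = 4 * T + 4 by lia.
  subst p1 p2 e; split; first by lia.
  by apply: Or44; split; lia.
Qed.

(** If two of [a, b, e] add up to at most half of [m = a + b + e], their product is at most
    [(m / 4)^2] by AM-GM, and a product bound suffices. Otherwise one well chosen [T] decides. *)
Lemma frame_arith (a b e k : nat) : 0 < k ->
  k <= a * b -> k <= a * e -> k <= b * e ->
  (forall T, 2 * T <= a -> 2 * T <= b ->
     k <= 2 * e * T + (a - 2 * T) * (b - 2 * T)) ->
  k <= G (a + b + e) \/ exists q, exceptional a b e k q.
Proof.
move=> k0 kab kae kbe kT.
have small (x : nat) : 16 * x <= (a + b + e) ^ 2 -> x <= G (a + b + e).
  move=> hx; have /andP[h _] := G_bound (a + b + e); apply: leq_trans h.
  by rewrite leq_divRL //; lia.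
have small2 x y : k <= x * y -> 2 * (x + y) <= a + b + e -> k <= G (a + b + e).
  move=> kxy hxy; apply: small; have [+ _] := nat_AGM2 x y.
  have : (2 * (x + y)) ^ 2 <= (a + b + e) ^ 2 by rewrite leq_exp2r.
  by rewrite expnMn -[2 ^ 2]/4; move: ((x + y) ^ 2) (_ ^ 2) => u v; lia.
case: (leqP (a + b + 2) e) => [h1|h1].
  by left; apply: small2 kab _; lia.
(* The frame bound is convex in [T] with minimum at [(a + b - e) / 4]; this rounding puts
   [x = e - (a - 2 T) - (b - 2 T)] between -2 and 1. *)
pose T := (a + b + 1 - e) %/ 4.
have [hT|hT] := leqP (2 * T) a; last first.
  by left; apply: small2 kae _; rewrite /T in hT; lia.
have [hT'|hT'] := leqP (2 * T) b; last first.
  by left; apply: small2 kbe _; rewrite /T in hT'; lia.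
have kv := kT T hT hT'.
case: (leqP k (G (a + b + e))) => hG; [by left | right; exists T].
have aE : a = (a - 2 * T) + 2 * T by rewrite subnK.
have bE : b = (b - 2 * T) + 2 * T by rewrite subnK.
by rewrite aE bE; apply: frame_value; rewrite -?aE -?bE // /T; lia.
Qed.

(** * Lines and frames *)

Lemma ord_eqE n (i j : 'I_n) : (i == j) = (i == j :> nat).
Proof. by []. Qed.

Section Lines.
Variable n : nat.
Implicit Types p q s : 'I_n * 'I_n.

Definition row (x : 'I_n) : {set 'I_n * 'I_n} := [set s : 'I_n * 'I_n | s.1 == x].
Definition column (y : 'I_n) : {set 'I_n * 'I_n} := [set s : 'I_n * 'I_n | s.2 == y].
Definition diag p : {set 'I_n * 'I_n} := [set s : 'I_n * 'I_n | s.1 + p.2 == p.1 + s.2].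
Definition anti p : {set 'I_n * 'I_n} := [set s : 'I_n * 'I_n | s.1 + s.2 == p.1 + p.2].

Lemma diag_eq p q : (diag p == diag q) = (p.1 + q.2 == q.1 + p.2).
Proof.
apply/eqP/eqP => [E|E]; last by apply/setP => s; rewrite !inE; lia.
have : p \in diag p by rewrite inE.
by rewrite E inE => /eqP.
Qed.

Lemma anti_eq p q : (anti p == anti q) = (p.1 + p.2 == q.1 + q.2).
Proof.
apply/eqP/eqP => [E|E]; last by apply/setP => s; rewrite !inE; lia.
have : p \in anti p by rewrite inE.
by rewrite E inE => /eqP.
Qed.

(** One of the two truncated differences is always zero, so this is [n - |p.1 - p.2|]; likewise
    [anti_len] is [n - |p.1 + p.2 + 1 - n|]. *)
Definition diag_len p : nat := n - (p.1 - p.2) - (p.2 - p.1).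
Definition anti_len p : nat := n - (p.1 + p.2 + 1 - n) - (n - (p.1 + p.2 + 1)).

Lemma card_line (x y : nat -> nat) (L : nat) (A : {set 'I_n * 'I_n}) :
  (forall i, i < L -> x i < n /\ y i < n) ->
  (forall i j, i < L -> j < L -> x i = x j -> i = j) ->
  (forall s, s \in A <-> exists2 i, i < L & s.1 = x i :> nat /\ s.2 = y i :> nat) ->
  #|A| = L.
Proof.
case: n A => [|n'] A hxy xinj hA.
  case: L hxy {xinj} hA => [|L] hxy hA; last by have [] := hxy 0 isT.
  by apply: eq_card0 => -[[]].
pose f (i : 'I_L) : 'I_n'.+1 * 'I_n'.+1 := (inord (x i), inord (y i)).
have -> : A = f @: [set: 'I_L].
  apply/setP => s; apply/idP/imsetP => [/hA [i iL [s1 s2]]|[i _ ->]].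
    exists (Ordinal iL) => //; rewrite /f /= -s1 -s2.
    by case: (s) => a b /=; rewrite !inord_val.
  by apply/hA; exists i => //; have [] := hxy i (ltn_ord i) => h1 h2; rewrite !inordK.
rewrite card_imset ?cardsT ?card_ord // => i j [/(congr1 val)] /=.
have [[h1 _] [h2 _]] := (hxy i (ltn_ord i), hxy j (ltn_ord j)).
by rewrite !inordK // => /xinj E _; apply/val_inj/E.
Qed.

Lemma card_row x : #|row x| = n.
Proof.
rewrite -[RHS](card_ord n) -(card_imset predT (f := fun y => (x, y))); last by move=> ? ? [].
apply: eq_card => s; rewrite inE; apply/eqP/imsetP => [E|[y _ ->] //].
by exists s.2; rewrite // -E; case: (s).
Qed.

Lemma card_column y : #|column y| = n.
Proof.
rewrite -[RHS](card_ord n) -(card_imset predT (f := fun x => (x, y))); last by move=> ? ? [].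
apply: eq_card => s; rewrite inE; apply/eqP/imsetP => [E|[x _ ->] //].
by exists s.1; rewrite // -E; case: (s).
Qed.

Lemma card_diag p : #|diag p| = diag_len p.
Proof.
apply: (@card_line (fun i => p.1 - p.2 + i) (fun i => p.2 - p.1 + i)).
- by move=> i; rewrite /diag_len; lia.
- by move=> i j _ _; lia.
move=> s; rewrite inE /diag_len; split=> [/eqP E|[i iL [E1 E2]]]; last by apply/eqP; lia.
by exists (s.1 - (p.1 - p.2)); [|split]; have := ltn_ord s.1; have := ltn_ord s.2; lia.
Qed.

Lemma card_anti p : #|anti p| = anti_len p.
Proof.
apply: (@card_line (fun i => p.1 + p.2 - n.-1 + i)
                   (fun i => minn (p.1 + p.2) n.-1 - i)).
- by move=> i; rewrite /anti_len; have := ltn_ord p.1; have := ltn_ord p.2; lia.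
- by move=> i j _ _; lia.
move=> s; rewrite inE /anti_len; have := ltn_ord p.1; have := ltn_ord p.2.
have := ltn_ord s.1; have := ltn_ord s.2.
split=> [/eqP E|[i iL [E1 E2]]]; last by apply/eqP; lia.
by exists (s.1 - (p.1 + p.2 - n.-1)); [|split]; lia.
Qed.

(** The offsets [p.1 - p.2] and [p.1 + p.2 + 1 - n] have sum [2 p.1 + 1 - n] and difference
    [-(2 p.2 + 1 - n)], both at most [n - 1] in absolute value. Hence so is the sum of their
    absolute values. *)
Lemma diag_anti_len p : n < #|diag p| + #|anti p|.
Proof.
rewrite card_diag card_anti /diag_len /anti_len.
by have := ltn_ord p.1; have := ltn_ord p.2; lia.
Qed.

End Lines.

(* Each line meets the hooks [left or bottom] and [right or top] at most once
   when it is increasing, and [left or top] and [right or bottom] at most once when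
   it is decreasing. *)
Section Frame.
Variables (n : nat) (PD PE : {set 'I_n * 'I_n}).
Variables (A B : {set 'I_n}) (x0 x1 y0 y1 : 'I_n).
Let e := #|@diag n @: PD| + #|@anti n @: PE|.

Definition spans (S : {set 'I_n}) (z0 z1 : 'I_n) : Prop :=
  [/\ z0 \in S, z1 \in S & forall z, z \in S -> z0 <= z <= z1].

Hypotheses (hA : spans A x0 x1) (hB : spans B y0 y1).

Definition block (A B : {set 'I_n}) : {set 'I_n * 'I_n} := [set p | (p.1 \in A) && (p.2 \in B)].

Definition hook (P : {set 'I_n * 'I_n}) (x y : 'I_n) : {set 'I_n * 'I_n} :=
  [set p in P | [&& p.1 \in A, p.2 \in B & (p.1 == x) || (p.2 == y)]].

Definition frame : {set 'I_n * 'I_n} :=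
  [set p in block A B | [|| p.1 == x0, p.1 == x1, p.2 == y0 | p.2 == y1]].

Let bounds p : p.1 \in A -> p.2 \in B -> x0 <= p.1 <= x1 /\ y0 <= p.2 <= y1.
Proof. by case: hA => _ _ h1; case: hB => _ _ h2 /h1 -> /h2 ->. Qed.

Lemma diag_hook_inj (x y : 'I_n) : (x, y) \in [:: (x0, y0); (x1, y1)] ->
  {in hook PD x y &, injective (@diag n)}.
Proof.
rewrite !inE => xy p q /setIdP[_ /and3P[pA pB ph]] /setIdP[_ /and3P[qA qB qh]] /eqP.
rewrite diag_eq => /eqP E; have [p1 p2] := bounds pA pB; have [q1 q2] := bounds qA qB.
suff [E1 E2] : p.1 = q.1 :> nat /\ p.2 = q.2 :> nat.
  by case: (p) (q) E1 E2 => [? ?] [? ?] /= /val_inj -> /val_inj ->.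
case/orP: xy ph qh => /eqP[-> ->]; rewrite !ord_eqE; case: (p) (q) E p1 p2 q1 q2.
  by move=> [? ?] [? ?] /=; lia.
by move=> [? ?] [? ?] /=; lia.
Qed.

Lemma anti_hook_inj (x y : 'I_n) : (x, y) \in [:: (x0, y1); (x1, y0)] ->
  {in hook PE x y &, injective (@anti n)}.
Proof.
rewrite !inE => xy p q /setIdP[_ /and3P[pA pB ph]] /setIdP[_ /and3P[qA qB qh]] /eqP.
rewrite anti_eq => /eqP E; have [p1 p2] := bounds pA pB; have [q1 q2] := bounds qA qB.
suff [E1 E2] : p.1 = q.1 :> nat /\ p.2 = q.2 :> nat.
  by case: (p) (q) E1 E2 => [? ?] [? ?] /= /val_inj -> /val_inj ->.
case/orP: xy ph qh => /eqP[-> ->]; rewrite !ord_eqE; case: (p) (q) E p1 p2 q1 q2.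
  by move=> [? ?] [? ?] /=; lia.
by move=> [? ?] [? ?] /=; lia.
Qed.

Lemma hook_sub P x y : hook P x y \subset P.
Proof. by apply/subsetP => p /setIdP[]. Qed.

Lemma card_diag_hook (x y : 'I_n) : (x, y) \in [:: (x0, y0); (x1, y1)] ->
  #|hook PD x y| <= #|@diag n @: PD|.
Proof.
move=> h; rewrite -(card_in_imset (diag_hook_inj h)).
exact/subset_leq_card/imsetS/hook_sub.
Qed.

Lemma card_anti_hook (x y : 'I_n) : (x, y) \in [:: (x0, y1); (x1, y0)] ->
  #|hook PE x y| <= #|@anti n @: PE|.
Proof.
move=> h; rewrite -(card_in_imset (anti_hook_inj h)).
exact/subset_leq_card/imsetS/hook_sub.
Qed.

Lemma hooks_diag : #|hook PD x0 y0| <= #|@diag n @: PD| /\ #|hook PD x1 y1| <= #|@diag n @: PD|.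
Proof. by split; apply: card_diag_hook; rewrite !inE eqxx ?orbT. Qed.

Lemma hooks_anti : #|hook PE x0 y1| <= #|@anti n @: PE| /\ #|hook PE x1 y0| <= #|@anti n @: PE|.
Proof. by split; apply: card_anti_hook; rewrite !inE eqxx ?orbT. Qed.

Lemma frame_cover : (PD :|: PE) :&: frame =
  (hook PD x0 y0 :|: hook PD x1 y1) :|: (hook PE x0 y1 :|: hook PE x1 y0).
Proof.
apply/setP => p; rewrite !inE.
by case: (p \in PD); case: (p \in PE); case: (p.1 \in A); case: (p.2 \in B);
  case: (p.1 == x0); case: (p.1 == x1); case: (p.2 == y0); case: (p.2 == y1).
Qed.

Lemma frame_le : #|(PD :|: PE) :&: frame| <= 2 * e.
Proof.
rewrite frame_cover /e.
have [h1 h2] := hooks_diag; have [h3 h4] := hooks_anti.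
have [+ _] := leq_card_setU (hook PD x0 y0) (hook PD x1 y1).
have [+ _] := leq_card_setU (hook PE x0 y1) (hook PE x1 y0).
have [+ _] := leq_card_setU (hook PD x0 y0 :|: hook PD x1 y1) (hook PE x0 y1 :|: hook PE x1 y0).
lia.
Qed.

(** Equality in [frame_le] leaves no slack in the four hook counts or in their union: each hook
    meets every line of its family, and no queen is counted twice. *)
Lemma frame_tight : 2 * e <= #|(PD :|: PE) :&: frame| ->
  [/\ forall p (x y : 'I_n), p \in PD -> (x, y) \in [:: (x0, y0); (x1, y1)] ->
        exists2 q, q \in hook PD x y & p.1 + q.2 = q.1 + p.2,
      forall p (x y : 'I_n), p \in PE -> (x, y) \in [:: (x0, y1); (x1, y0)] ->
        exists2 q, q \in hook PE x y & p.1 + p.2 = q.1 + q.2,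
      [disjoint hook PD x0 y0 & hook PD x1 y1],
      [disjoint hook PE x0 y1 & hook PE x1 y0] &
      [disjoint PD :&: frame & PE]].
Proof.
rewrite frame_cover /e.
have [h1 h3] := hooks_diag; have [h2 h4] := hooks_anti.
have c1 := cardsUI (hook PD x0 y0) (hook PD x1 y1).
have c2 := cardsUI (hook PE x0 y1) (hook PE x1 y0).
have c3 := cardsUI (hook PD x0 y0 :|: hook PD x1 y1) (hook PE x0 y1 :|: hook PE x1 y0).
move=> tight.
have [e1 e2] : #|@diag n @: PD| <= #|hook PD x0 y0| /\ #|@diag n @: PD| <= #|hook PD x1 y1| by lia.
have [e3 e4] : #|@anti n @: PE| <= #|hook PE x0 y1| /\ #|@anti n @: PE| <= #|hook PE x1 y0| by lia.
have dsurj (x y : 'I_n) : (x, y) \in [:: (x0, y0); (x1, y1)] -> @diag n @: hook PD x y = @diag n @: PD.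
  move=> h; apply/eqP; rewrite eqEcard imsetS ?hook_sub //=.
  have -> : #|@diag n @: hook PD x y| = #|hook PD x y| := card_in_imset (diag_hook_inj h).
  by move: h; rewrite !inE => /orP[] /eqP[-> ->].
have asurj (x y : 'I_n) : (x, y) \in [:: (x0, y1); (x1, y0)] -> @anti n @: hook PE x y = @anti n @: PE.
  move=> h; apply/eqP; rewrite eqEcard imsetS ?hook_sub //=.
  have -> : #|@anti n @: hook PE x y| = #|hook PE x y| := card_in_imset (anti_hook_inj h).
  by move: h; rewrite !inE => /orP[] /eqP[-> ->].
split.
- move=> p x y pP /dsurj E; have : diag p \in @diag n @: PD by apply: imset_f.
  by rewrite -E => /imsetP[q qh /eqP]; rewrite diag_eq => /eqP; exists q.
- move=> p x y pP /asurj E; have : anti p \in @anti n @: PE by apply: imset_f.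
  by rewrite -E => /imsetP[q qh /eqP]; rewrite anti_eq => /eqP; exists q.
- by rewrite -setI_eq0 -cards_eq0; lia.
- by rewrite -setI_eq0 -cards_eq0; lia.
have : #|(hook PD x0 y0 :|: hook PD x1 y1) :&: (hook PE x0 y1 :|: hook PE x1 y0)| == 0 by lia.
rewrite cards_eq0 -setI_eq0 => /eqP E; apply/eqP/setP => p; move/setP/(_ p): E; rewrite !inE.
by case: (p \in PD); case: (p \in PE); case: (p.1 \in A); case: (p.2 \in B);
  case: (p.1 == x0); case: (p.1 == x1); case: (p.2 == y0); case: (p.2 == y1).
Qed.

End Frame.

(** * Peeling off frames *)

Lemma spans_exists n (S : {set 'I_n}) : 0 < #|S| -> exists z0 z1, spans S z0 z1.
Proof.
case/card_gt0P => z zS.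
have [z0 z0S min0] := arg_minnP (@nat_of_ord n) zS.
have [z1 z1S max1] := arg_maxnP (@nat_of_ord n) zS.
by exists z0, z1; split=> // t tS; rewrite min0 //; apply: max1.
Qed.

Lemma spans_lt n (S : {set 'I_n}) z0 z1 : 1 < #|S| -> spans S z0 z1 -> z0 < z1.
Proof.
move=> /card_gt1P[s [t [sS tS st]]] [_ _ h].
by have := h s sS; have := h t tS; move: st; rewrite ord_eqE; lia.
Qed.

Definition inner n (S : {set 'I_n}) (z0 z1 : 'I_n) := S :\: [set z0; z1].

Lemma in_inner n (S : {set 'I_n}) z0 z1 z : spans S z0 z1 ->
  (z \in inner S z0 z1) = (z \in S) && (z0 < z < z1).
Proof.
move=> [_ _ h]; rewrite !inE !ord_eqE andbC; case zS: (z \in S) => //=.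
by have := h z zS; lia.
Qed.

Lemma card_inner n (S : {set 'I_n}) z0 z1 : 1 < #|S| -> spans S z0 z1 ->
  #|inner S z0 z1| = #|S| - 2.
Proof.
move=> S2 hS; have z01 := spans_lt S2 hS; case: hS => z0S z1S _.
have := cardsID [set z0; z1] S; rewrite (setIidPr _); last first.
  by apply/subsetP => z; rewrite !inE => /orP[] /eqP->.
by rewrite cards2 ord_eqE -/(inner S z0 z1) neq_ltn z01 => <-; rewrite addKn.
Qed.

Section Blocks.
Variables (n : nat) (PD PE : {set 'I_n * 'I_n}).
Let e := #|@diag n @: PD| + #|@anti n @: PE|.
Implicit Types A B : {set 'I_n}.

Lemma card_block A B : #|block A B| = #|A| * #|B|.
Proof. by rewrite -cardsX; apply: eq_card => p; rewrite !inE. Qed.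

Lemma block_split A B x0 x1 y0 y1 :
  block A B = frame A B x0 x1 y0 y1 :|: block (inner A x0 x1) (inner B y0 y1).
Proof.
apply/setP => p; rewrite !inE.
by case: (p.1 \in A); case: (p.2 \in B); case: (p.1 == x0); case: (p.1 == x1);
  case: (p.2 == y0); case: (p.2 == y1).
Qed.

Lemma block_split_card A B x0 x1 y0 y1 (P : {set 'I_n * 'I_n}) :
  #|P :&: block A B| = #|P :&: frame A B x0 x1 y0 y1|
     + #|P :&: block (inner A x0 x1) (inner B y0 y1)|.
Proof.
rewrite (block_split _ _ x0 x1 y0 y1) setIUr cardsU; set X := (X in _ - X).
suff -> : X = 0 by rewrite subn0.
apply/eqP; rewrite cards_eq0; apply/eqP/setP => p; rewrite !inE.
by case: (p.1 \in A); case: (p.2 \in B); case: (p.1 == x0); case: (p.1 == x1);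
  case: (p.2 == y0); case: (p.2 == y1); rewrite !(andbF, andbT).
Qed.

Lemma peel A B T : 2 * T <= #|A| -> 2 * T <= #|B| ->
  exists A' B', [/\ #|A'| = #|A| - 2 * T, #|B'| = #|B| - 2 * T &
   #|(PD :|: PE) :&: block A B| <= 2 * e * T + #|(PD :|: PE) :&: block A' B'|].
Proof.
elim: T => [|T IH] hA hB; first by exists A, B; rewrite !muln0 !subn0.
case: IH => [||A' [B' [cA cB h]]]; [lia|lia|].
have A2 : 1 < #|A'| by lia.
have B2 : 1 < #|B'| by lia.
have [x0 [x1 sA]] := spans_exists (ltnW A2).
have [y0 [y1 sB]] := spans_exists (ltnW B2).
exists (inner A' x0 x1), (inner B' y0 y1); rewrite !card_inner //.
split; [lia|lia|apply: (leq_trans h)].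
rewrite (block_split_card A' B' x0 x1 y0 y1).
have := frame_le PD PE sA sB; rewrite -/e.
by move: #|_ :&: frame _ _ _ _ _ _| => u; move: #|_ :&: block (inner _ _ _) _| => v; lia.
Qed.

Lemma card_imset_fiber (T : finType) (P : {set 'I_n * 'I_n}) (f : 'I_n * 'I_n -> T)
    (g : 'I_n * 'I_n -> 'I_n) (C : {set 'I_n}) :
  (forall p, p \in P -> g p \in C) -> {in P &, injective (fun p => (g p, f p))} ->
  #|P| <= #|C| * #|f @: P|.
Proof.
move=> gC inj; rewrite -(card_in_imset inj) -cardsX; apply/subset_leq_card/subsetP => q.
by case/imsetP => p pP ->; rewrite !inE /= gC // imset_f.
Qed.

(** A point is determined by its row, or its column, together with a line through it, so each row
    and each column holds at most [e] queens. *)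
Lemma block_le A B : PD :|: PE \subset block A B ->
  [/\ #|PD :|: PE| <= #|A| * #|B|, #|PD :|: PE| <= #|A| * e & #|PD :|: PE| <= #|B| * e].
Proof.
move=> /subsetP sub; split; first by rewrite -card_block; apply/subset_leq_card/subsetP.
- rewrite cardsU mulnDr; apply: leq_trans (leq_subr _ _) _; apply: leq_add.
    apply: (card_imset_fiber (g := fst)) => [p pP|[? ?] [? ?] _ _ []].
      by have := sub p; rewrite !inE pP /= => /(_ isT)/andP[].
    by move=> <- /eqP; rewrite diag_eq /= eqn_add2l => /eqP/val_inj ->.
  apply: (card_imset_fiber (g := fst)) => [p pP|[? ?] [? ?] _ _ []].
    by have := sub p; rewrite !inE pP orbT /= => /(_ isT)/andP[].
  by move=> <- /eqP; rewrite anti_eq /= eqn_add2l => /eqP/val_inj ->.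
- rewrite cardsU mulnDr; apply: leq_trans (leq_subr _ _) _; apply: leq_add.
    apply: (card_imset_fiber (g := snd)) => [p pP|[? ?] [? ?] _ _ []].
      by have := sub p; rewrite !inE pP /= => /(_ isT)/andP[].
    by move=> <- /eqP; rewrite diag_eq /= eqn_add2r => /eqP/val_inj ->.
  apply: (card_imset_fiber (g := snd)) => [p pP|[? ?] [? ?] _ _ []].
    by have := sub p; rewrite !inE pP orbT /= => /(_ isT)/andP[].
  by move=> <- /eqP; rewrite anti_eq /= eqn_add2r => /eqP/val_inj ->.
Qed.

(** Send the points of [PD] to their diagonals and the others, which lie in [PE], to their
    antidiagonals; both maps are injective on [S]. *)
Lemma card_inj_lines (S : {set 'I_n * 'I_n}) : S \subset PD :|: PE ->
  {in S &, forall p q : 'I_n * 'I_n, p.1 + q.2 = q.1 + p.2 -> p = q} ->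
  {in S &, forall p q : 'I_n * 'I_n, p.1 + p.2 = q.1 + q.2 -> p = q} -> #|S| <= e.
Proof.
move=> sub hD hE; rewrite -(cardsID PD S); apply: leq_add.
  rewrite -(card_in_imset (f := @diag n)); first exact/subset_leq_card/imsetS/subsetIr.
  by move=> p q /setIP[pS _] /setIP[qS _] /eqP; rewrite diag_eq => /eqP; apply: hD.
rewrite -(card_in_imset (f := @anti n)).
  apply/subset_leq_card/imsetS/subsetP => p /setDP[/(subsetP sub)].
  by rewrite inE => /orP[->|].
by move=> p q /setDP[pS _] /setDP[qS _] /eqP; rewrite anti_eq => /eqP; apply: hE.
Qed.

(** No line joins a point of [A] at height [y0] to a point of [A'] at height [y1], so
    [card_inj_lines] applies to the union of these two sets. *)
Lemma two_rows A A' B (y0 y1 : 'I_n) : block A B \subset PD :|: PE -> A' \subset A ->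
  y0 \in B -> y1 \in B -> y0 < y1 ->
  (forall x x' : 'I_n, x \in A -> x' \in A' -> x + y1 <> x' + y0 /\ x + y0 <> x' + y1) ->
  #|A| + #|A'| <= e.
Proof.
move=> /subsetP sub /subsetP sA y0B y1B y01 h.
pose S := setX A [set y0] :|: setX A' [set y1].
have -> : #|A| + #|A'| = #|S|.
  rewrite cardsU !cardsX !cards1 !muln1; set X := (X in _ - X).
  suff -> : X = 0 by rewrite subn0.
  apply/eqP; rewrite cards_eq0; apply/eqP/setP => p; rewrite !inE !ord_eqE.
  by apply/negP => /andP[/andP[_ /eqP E1] /andP[_ /eqP E2]]; lia.
apply: card_inj_lines.
- apply/subsetP => -[x y]; rewrite !in_setU !in_setX !in_set1 => H; rewrite -in_setU; apply: sub.
  by rewrite inE /=; case/orP: H => /andP[H1 /eqP->]; rewrite ?H1 ?(sA _ H1) ?y0B.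
- move=> [x y] [x' y']; rewrite !inE /= => /orP[] /andP[H1 /eqP->] /orP[] /andP[H2 /eqP->] E.
  + by congr pair; apply: val_inj => /=; lia.
  + by have [] := h x x' H1 H2; lia.
  + by have [] := h x' x H2 H1; lia.
  + by congr pair; apply: val_inj => /=; lia.
- move=> [x y] [x' y']; rewrite !inE /= => /orP[] /andP[H1 /eqP->] /orP[] /andP[H2 /eqP->] E.
  + by congr pair; apply: val_inj => /=; lia.
  + by have [] := h x x' H1 H2; lia.
  + by have [] := h x' x H2 H1; lia.
  + by congr pair; apply: val_inj => /=; lia.
Qed.

Lemma two_columns A B B' (x0 x1 : 'I_n) : block A B \subset PD :|: PE -> B' \subset B ->
  x0 \in A -> x1 \in A -> x0 < x1 ->
  (forall y y' : 'I_n, y \in B -> y' \in B' -> x0 + y' <> x1 + y /\ x0 + y <> x1 + y') ->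
  #|B| + #|B'| <= e.
Proof.
move=> /subsetP sub /subsetP sB x0A x1A x01 h.
pose S := setX [set x0] B :|: setX [set x1] B'.
have -> : #|B| + #|B'| = #|S|.
  rewrite cardsU !cardsX !cards1 !mul1n; set X := (X in _ - X).
  suff -> : X = 0 by rewrite subn0.
  apply/eqP; rewrite cards_eq0; apply/eqP/setP => p; rewrite !inE !ord_eqE.
  by apply/negP => /andP[/andP[/eqP E1 _] /andP[/eqP E2 _]]; lia.
apply: card_inj_lines.
- apply/subsetP => -[x y]; rewrite !in_setU !in_setX !in_set1 => H; rewrite -in_setU; apply: sub.
  by rewrite inE /=; case/orP: H => /andP[/eqP-> H1]; rewrite ?H1 ?(sB _ H1) ?x0A ?x1A.
- move=> [x y] [x' y']; rewrite !inE /= => /orP[] /andP[/eqP-> H1] /orP[] /andP[/eqP-> H2] E.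
  + by congr pair; apply: val_inj => /=; lia.
  + by have [] := h y y' H1 H2; lia.
  + by have [] := h y' y H2 H1; lia.
  + by congr pair; apply: val_inj => /=; lia.
- move=> [x y] [x' y']; rewrite !inE /= => /orP[] /andP[/eqP-> H1] /orP[] /andP[/eqP-> H2] E.
  + by congr pair; apply: val_inj => /=; lia.
  + by have [] := h y y' H1 H2; lia.
  + by have [] := h y' y H2 H1; lia.
  + by congr pair; apply: val_inj => /=; lia.
Qed.

(* If the block is at least as tall as wide, only its two main diagonals can meet both
   horizontal sides, and only when it is a square.  So the [2 |A|] points of these sides
   lie on at least [2 |A| - 2] lines, and on [2 |A|] lines unless the block is a square. *)
Lemma full_block_square A B (x0 x1 y0 y1 : 'I_n) :
  1 < #|A| -> 1 < #|B| -> spans A x0 x1 -> spans B y0 y1 ->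
  block A B \subset PD :|: PE -> #|A| + #|B| = e + 2 ->
  #|A| <= #|B| + 1 -> #|B| <= #|A| + 1 -> #|A| = #|B| /\ x1 - x0 = y1 - y0.
Proof.
move=> A2 B2 sA sB sub hAB h1 h2.
have x01 := spans_lt A2 sA; have y01 := spans_lt B2 sB.
have [x0A x1A xb] := sA; have [y0B y1B yb] := sB.
have [H|H|H] := ltngtP (x1 - x0) (y1 - y0).
- suff : #|A| + #|A| <= e by lia.
  apply: (two_rows (y0 := y0) (y1 := y1) sub) => // x x' /xb ? /xb ?; lia.
- suff : #|B| + #|B| <= e by lia.
  apply: (two_columns (x0 := x0) (x1 := x1) sub) => // y y' /yb ? /yb ?; lia.
split=> //.
have : #|A| + #|inner A x0 x1| <= e.
  apply: (two_rows (y0 := y0) (y1 := y1) sub) => //; first exact: subsetDl.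
  by move=> x x' /xb ?; rewrite in_inner // => /andP[_ ?]; lia.
have : #|B| + #|inner B y0 y1| <= e.
  apply: (two_columns (x0 := x0) (x1 := x1) sub) => //; first exact: subsetDl.
  by move=> y y' /yb ?; rewrite in_inner // => /andP[_ ?]; lia.
by rewrite !card_inner //; lia.
Qed.

End Blocks.

(** * Tight squares *)

(** Steps of length [u] lead from [y] down to [z0] inside [S], and each step reaches a new element
    of [S] below [y]. [ascend] is the mirror image. *)
Lemma descend n (S : {set 'I_n}) (z0 y : 'I_n) u : 0 < u ->
  (forall z, z \in S -> z0 <= z) -> y \in S ->
  (forall z : 'I_n, z \in S -> z0 < z <= y -> exists2 w : 'I_n, w \in S & w + u = z) ->
  y <= z0 + u * #|[set z : 'I_n in S | z < y]|.
Proof.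
move=> u0 lb; have [k] := ubnP (y : nat); elim: k y => // k IH y yk yS h.
have := lb y yS; rewrite leq_eqVlt => /orP[/eqP -> |zy]; first exact: leq_addr.
have [|w wS wy] := h y yS; first by rewrite zy /=.
have hw : w <= z0 + u * #|[set z : 'I_n in S | z < w]|.
  by apply: IH => // [|z zS zw]; [lia | apply: h => //; lia].
have : #|[set z : 'I_n in S | z < w]| < #|[set z : 'I_n in S | z < y]|.
  apply: proper_card; apply/properP; split; last by exists w; rewrite !inE ?wS /=; lia.
  by apply/subsetP => z; rewrite !inE => /andP[-> ?] /=; lia.
by move: hw; move: #|_| #|_| => a b; nia.
Qed.

Lemma ascend n (S : {set 'I_n}) (z1 y : 'I_n) u : 0 < u ->
  (forall z, z \in S -> z <= z1) -> y \in S ->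
  (forall z : 'I_n, z \in S -> y <= z < z1 -> exists2 w : 'I_n, w \in S & z + u = w) ->
  z1 <= y + u * #|[set z : 'I_n in S | y < z]|.
Proof.
move=> u0 ub; have [k] := ubnP (z1 - y); elim: k y => // k IH y yk yS h.
have := ub y yS; rewrite leq_eqVlt => /orP[/eqP -> |zy]; first exact: leq_addr.
have [|w wS wy] := h y yS; first by rewrite zy leqnn.
have hw : z1 <= w + u * #|[set z : 'I_n in S | w < z]|.
  by apply: IH => // [|z zS zw]; [lia | apply: h => //; lia].
have : #|[set z : 'I_n in S | w < z]| < #|[set z : 'I_n in S | y < z]|.
  apply: proper_card; apply/properP; split; last by exists w; rewrite !inE ?wS /=; lia.
  by apply/subsetP => z; rewrite !inE => /andP[-> ?] /=; lia.
by move: hw; move: #|_| #|_| => a b; nia.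
Qed.

Lemma card_le_rel n (S T : {set 'I_n}) (R : rel 'I_n) :
  (forall y, y \in S -> exists2 x, x \in T & R x y) ->
  (forall x y y', R x y -> R x y' -> y = y') -> #|S| <= #|T|.
Proof.
move=> hR inj; pose g x := odflt x [pick y | R x y].
apply: leq_trans (leq_imset_card g T); apply/subset_leq_card/subsetP => y /hR[x xT Rxy].
apply/imsetP; exists x => //; rewrite /g; case: pickP => [y' /(inj _ _ _ Rxy)//|/(_ y)].
by rewrite Rxy.
Qed.

(* [A2] x [B2] is the full inner block, [A1] x [B1] adds the next frame, and [PD], [PE]
   are the queens on selected diagonals and antidiagonals.  Since every selected line
   meets both frames twice, the lines through the sides of the inner square continue to
   points of the outer frame: this shifts rows and columns by the gap [u]. *)
Section TightSquare.
Variables (n : nat) (PD PE : {set 'I_n * 'I_n}).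
Let e := #|@diag n @: PD| + #|@anti n @: PE|.
Variables (A1 B1 : {set 'I_n}) (x0' x1' y0' y1' x0 x1 y0 y1 : 'I_n) (p : nat).
Let A2 := inner A1 x0' x1'.
Let B2 := inner B1 y0' y1'.
Hypotheses (sA1 : spans A1 x0' x1') (sB1 : spans B1 y0' y1').
Hypotheses (sA2 : spans A2 x0 x1) (sB2 : spans B2 y0 y1).
Hypothesis full : block A2 B2 \subset PD :|: PE.
Hypotheses (cA2 : #|A2| = p.+1) (cB2 : #|B2| = p.+1) (p_even : ~~ odd p) (p_gt1 : 1 < p).
Hypothesis eE : e = 2 * p.
Hypothesis outer_tight : 2 * e <= #|(PD :|: PE) :&: frame A1 B1 x0' x1' y0' y1'|.
Hypothesis convexD : forall q r s : 'I_n * 'I_n, q \in PD -> r \in PD ->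
  s \in PD :|: PE -> q.1 + s.2 <= s.1 + q.2 -> s.1 + r.2 <= r.1 + s.2 -> s \in PD.
Hypothesis convexE : forall q r s : 'I_n * 'I_n, q \in PE -> r \in PE ->
  s \in PD :|: PE -> q.1 + q.2 <= s.1 + s.2 -> s.1 + s.2 <= r.1 + r.2 -> s \in PE.

Ltac arith :=
  clear convexD convexE outer_tight eE p_even p_gt1 cA2 cB2 full sA1 sA2 sB1 sB2;
  try clear e; clearbody A2 B2; lia.

Lemma square : x1 - x0 = y1 - y0.
Proof.
apply: (proj2 (full_block_square _ _ sA2 sB2 full _ _ _)); rewrite ?cA2 ?cB2 //; lia.
Qed.

Lemma x01 : x0 < x1. Proof. by apply: spans_lt sA2; rewrite cA2; lia. Qed.
Lemma y01 : y0 < y1. Proof. by apply: spans_lt sB2; rewrite cB2; lia. Qed.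
Lemma x0A : x0 \in A2. Proof. by case: sA2. Qed.
Lemma x1A : x1 \in A2. Proof. by case: sA2. Qed.
Lemma y0B : y0 \in B2. Proof. by case: sB2. Qed.
Lemma y1B : y1 \in B2. Proof. by case: sB2. Qed.

Lemma inA2 z : z \in A2 -> [/\ z \in A1, x0' < z < x1' & x0 <= z <= x1].
Proof. by move=> zA; case: sA2 => _ _ /(_ z zA); move: zA; rewrite in_inner // => /andP[]. Qed.
Lemma inB2 z : z \in B2 -> [/\ z \in B1, y0' < z < y1' & y0 <= z <= y1].
Proof. by move=> zB; case: sB2 => _ _ /(_ z zB); move: zB; rewrite in_inner // => /andP[]. Qed.

Lemma caseA1 z : z \in A1 -> [\/ z = x0', z = x1' | z \in A2].
Proof.
rewrite !inE => ->; rewrite andbT negb_or.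
by have [->|_] := eqVneq z x0'; [apply: Or31 | have [->|_] := eqVneq z x1'; [apply: Or32 | apply: Or33]].
Qed.
Lemma caseB1 z : z \in B1 -> [\/ z = y0', z = y1' | z \in B2].
Proof.
rewrite !inE => ->; rewrite andbT negb_or.
by have [->|_] := eqVneq z y0'; [apply: Or31 | have [->|_] := eqVneq z y1'; [apply: Or32 | apply: Or33]].
Qed.

Lemma inP a b : a \in A2 -> b \in B2 -> (a, b) \in PD :|: PE.
Proof. by move=> aA bB; apply: (subsetP full); rewrite inE aA. Qed.

Lemma inPDE a b : a \in A2 -> b \in B2 -> (a, b) \in PD \/ (a, b) \in PE.
Proof. by move=> aA bB; have := inP aA bB; rewrite inE => /orP. Qed.

(** The full block has [(p + 1)^2] queens and its interior at most [(p - 1)^2]; the difference is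
    [4 p = 2 e]. *)
Lemma inner_tight : 2 * e <= #|(PD :|: PE) :&: frame A2 B2 x0 x1 y0 y1|.
Proof.
have := block_split_card A2 B2 x0 x1 y0 y1 (PD :|: PE).
rewrite (setIidPr full) card_block.
have : #|(PD :|: PE) :&: block (inner A2 x0 x1) (inner B2 y0 y1)| <= p.-1 * p.-1.
  apply: leq_trans (subset_leq_card (subsetIr _ _)) _.
  have cA : #|inner A2 x0 x1| = p.-1 by rewrite card_inner ?cA2 //; lia.
  have cB : #|inner B2 y0 y1| = p.-1 by rewrite card_inner ?cB2 //; lia.
  by rewrite card_block cA cB.
rewrite cA2 cB2 eE; move: #|_ :&: block _ _| #|_ :&: frame _ _ _ _ _ _| => u v.
by case: (p) p_gt1 => // p'; rewrite /=; nia.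
Qed.

Lemma hookP (A B : {set 'I_n}) P (x y : 'I_n) q : q \in hook A B P x y ->
  [/\ q \in P, q.1 \in A, q.2 \in B & q.1 = x \/ q.2 = y].
Proof. by rewrite inE => /and4P[-> -> -> /orP[] /eqP ->]; split; auto. Qed.

Lemma mem_hook (A B P : {set _}) (x y a b : 'I_n) : (a, b) \in P -> a \in A -> b \in B ->
  (a == x) || (b == y) -> (a, b) \in hook A B P x y.
Proof. by move=> h1 h2 h3 h4; rewrite in_set /= h1 h2 h3 h4. Qed.

(** The corner [(x0, y0)] belongs to both hooks used for antidiagonals. By tightness these hooks
    share no point of [PE], so this queen is in [PD]; the other corners are similar. *)
Lemma corners : [/\ (x0, y0) \in PD, (x1, y1) \in PD, (x0, y1) \in PE & (x1, y0) \in PE].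
Proof.
have [_ _ dD dE _] := frame_tight sA2 sB2 inner_tight.
have noE a b : (a == x0) || (b == y1) -> (a == x1) || (b == y0) -> a \in A2 -> b \in B2 ->
    (a, b) \in PD.
  move=> h1 h2 aA bB; have [//|E] := inPDE aA bB.
  by have := disjointFr dE (mem_hook E aA bB h1); rewrite mem_hook.
have noD a b : (a == x0) || (b == y0) -> (a == x1) || (b == y1) -> a \in A2 -> b \in B2 ->
    (a, b) \in PE.
  move=> h1 h2 aA bB; have [E|//] := inPDE aA bB.
  by have := disjointFr dD (mem_hook E aA bB h1); rewrite mem_hook.
by split; [apply: noE|apply: noE|apply: noD|apply: noD]; rewrite ?eqxx ?orbT ?x0A ?x1A ?y0B ?y1B.
Qed.

Lemma outerD (x y a b : 'I_n) : (a, b) \in PD -> (x, y) \in [:: (x0', y0'); (x1', y1')] ->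
  exists c d : 'I_n, [/\ c \in A1, d \in B1, c = x \/ d = y & a + d = c + b].
Proof.
move=> h1 h2; have [/(_ _ _ _ h1 h2) [[c d] /hookP[_ ? ? ?] /= E] _ _ _ _] :=
  frame_tight sA1 sB1 outer_tight.
by exists c, d.
Qed.

Lemma outerE (x y a b : 'I_n) : (a, b) \in PE -> (x, y) \in [:: (x0', y1'); (x1', y0')] ->
  exists c d : 'I_n, [/\ c \in A1, d \in B1, c = x \/ d = y & a + b = c + d].
Proof.
move=> h1 h2; have [_ /(_ _ _ _ h1 h2) [[c d] /hookP[_ ? ? ?] /= E] _ _ _] :=
  frame_tight sA1 sB1 outer_tight.
by exists c, d.
Qed.

Lemma innerD (x y a b : 'I_n) : (a, b) \in PD -> (x, y) \in [:: (x0, y0); (x1, y1)] ->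
  exists c d : 'I_n, [/\ (c, d) \in PD, c \in A2, d \in B2, c = x \/ d = y & a + d = c + b].
Proof.
move=> h1 h2; have [/(_ _ _ _ h1 h2) [[c d] /hookP[? ? ? ?] /= E] _ _ _ _] :=
  frame_tight sA2 sB2 inner_tight.
by exists c, d.
Qed.

Lemma innerE (x y a b : 'I_n) : (a, b) \in PE -> (x, y) \in [:: (x0, y1); (x1, y0)] ->
  exists c d : 'I_n, [/\ (c, d) \in PE, c \in A2, d \in B2, c = x \/ d = y & a + b = c + d].
Proof.
move=> h1 h2; have [_ /(_ _ _ _ h1 h2) [[c d] /hookP[? ? ? ?] /= E] _ _ _] :=
  frame_tight sA2 sB2 inner_tight.
by exists c, d.
Qed.

Lemma m1 (T : eqType) (a b : T) : a \in [:: a; b]. Proof. exact: mem_head. Qed.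
Lemma m2 (T : eqType) (a b : T) : b \in [:: a; b]. Proof. by rewrite !inE eqxx orbT. Qed.

Definition gap (u : nat) : Prop :=
  [/\ 0 < u, x0' + u = x0, y0' + u = y0, x1 + u = x1' & y1 + u = y1'].

(** The selected line through an inner corner meets the outer frame at a grid point beyond that
    corner, which can only be the outer corner. Three corners equate the four distances. *)
Lemma gap_exists : exists u, gap u.
Proof.
have [c00 c11 c01 c10] := corners.
have [_ bx0 _] := inA2 x0A; have [_ bx1 _] := inA2 x1A.
have [_ by0 _] := inB2 y0B; have [_ by1 _] := inB2 y1B.
have g1 : x0 - x0' = y0 - y0'.
  have [c [d [/caseA1 cA /caseB1 dB E1 E2]]] := outerD c00 (m1 _ _).
  case: E1 => E1; subst.
    by case: dB E2 => [->|->|/inB2[_ _ ?]]; arith.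
  by case: cA E2 => [->|->|/inA2[_ _ ?]]; arith.
have g2 : x1' - x1 = y1' - y1.
  have [c [d [/caseA1 cA /caseB1 dB E1 E2]]] := outerD c11 (m2 _ _).
  case: E1 => E1; subst.
    by case: dB E2 => [->|->|/inB2[_ _ ?]]; arith.
  by case: cA E2 => [->|->|/inA2[_ _ ?]]; arith.
have g3 : x0 - x0' = y1' - y1.
  have [c [d [/caseA1 cA /caseB1 dB E1 E2]]] := outerE c01 (m1 _ _).
  case: E1 => E1; subst.
    by case: dB E2 => [->|->|/inB2[_ _ ?]]; arith.
  by case: cA E2 => [->|->|/inA2[_ _ ?]]; arith.
by exists (x0 - x0'); split; arith.
Qed.

(** The diagonal continues to [x0'] at height [y - u]. This height is strictly between [y0'] and
    [y1'], hence in [B2]. The next three lemmas are its reflections. *)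
Lemma left_down u (y : 'I_n) : gap u -> y \in B2 -> y0 < y < y1 -> (x0, y) \in PD ->
  exists2 w : 'I_n, w \in B2 & w + u = y.
Proof.
move=> [g0 g1 g2 g3 g4] yB hy h; have X01 := x01; have Y01 := y01.
have [c [d [/caseA1 cA /caseB1 dB E1 E2]]] := outerD h (m1 _ _).
case: E1 => E1; subst.
  by case: dB E2 => [->|->|dB] E2; [arith|arith|exists d => //; arith].
by case: cA E2 => [->|->|/inA2[_ _ ?]]; arith.
Qed.

Lemma right_up u (y : 'I_n) : gap u -> y \in B2 -> y0 < y < y1 -> (x1, y) \in PD ->
  exists2 w : 'I_n, w \in B2 & y + u = w.
Proof.
move=> [g0 g1 g2 g3 g4] yB hy h; have X01 := x01; have Y01 := y01.
have [c [d [/caseA1 cA /caseB1 dB E1 E2]]] := outerD h (m2 _ _).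
case: E1 => E1; subst.
  by case: dB E2 => [->|->|dB] E2; [arith|arith|exists d => //; arith].
by case: cA E2 => [->|->|/inA2[_ _ ?]]; arith.
Qed.

Lemma left_up u (y : 'I_n) : gap u -> y \in B2 -> y0 < y < y1 -> (x0, y) \in PE ->
  exists2 w : 'I_n, w \in B2 & y + u = w.
Proof.
move=> [g0 g1 g2 g3 g4] yB hy h; have X01 := x01; have Y01 := y01.
have [c [d [/caseA1 cA /caseB1 dB E1 E2]]] := outerE h (m1 _ _).
case: E1 => E1; subst.
  by case: dB E2 => [->|->|dB] E2; [arith|arith|exists d => //; arith].
by case: cA E2 => [->|->|/inA2[_ _ ?]]; arith.
Qed.

Lemma right_down u (y : 'I_n) : gap u -> y \in B2 -> y0 < y < y1 -> (x1, y) \in PE ->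
  exists2 w : 'I_n, w \in B2 & w + u = y.
Proof.
move=> [g0 g1 g2 g3 g4] yB hy h; have X01 := x01; have Y01 := y01.
have [c [d [/caseA1 cA /caseB1 dB E1 E2]]] := outerE h (m2 _ _).
case: E1 => E1; subst.
  by case: dB E2 => [->|->|dB] E2; [arith|arith|exists d => //; arith].
by case: cA E2 => [->|->|/inA2[_ _ ?]]; arith.
Qed.

Lemma frame_disjoint (a b : 'I_n) : a \in A2 -> b \in B2 -> (b == y0) || (b == y1) ->
  (a, b) \in PD -> (a, b) \in PE -> False.
Proof.
move=> aA bB hb hD hE; have [_ _ _ _] := frame_tight sA2 sB2 inner_tight.
move/disjointFr => /(_ (a, b)); rewrite hE => H; have : true = false; last by [].
by apply: H; rewrite in_setI hD [_ \in frame _ _ _ _ _ _]in_set [_ \in block _ _]in_set /= aA bB hb !orbT.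
Qed.

Let Bo := inner B2 y0 y1.
Let LD := [set y in Bo | (x0, y) \in PD].
Let LE := [set y in Bo | (x0, y) \in PE].
Let RD := [set y in Bo | (x1, y) \in PD].
Let RE := [set y in Bo | (x1, y) \in PE].
Let side P b := [set x in inner A2 x0 x1 | (x, b) \in (P : {set 'I_n * 'I_n})].

Lemma inBo y : (y \in Bo) = (y \in B2) && (y0 < y < y1).
Proof. exact: in_inner. Qed.

Lemma side_card b : b \in B2 -> (b == y0) || (b == y1) -> #|side PD b| + #|side PE b| <= p.-1.
Proof.
move=> bB hb; have -> : p.-1 = #|inner A2 x0 x1| by rewrite card_inner ?cA2 //; lia.
rewrite -cardsUI; set X := _ :&: _; have -> : X = set0.
  apply/setP => x; rewrite in_setI [_ \in side PD b]in_set [_ \in side PE b]in_set in_inner // in_set0.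
  apply/negP => /andP[/andP[/andP[xA _] h1] /andP[_ h2]].
  exact: frame_disjoint xA bB hb h1 h2.
rewrite cards0 addn0; apply/subset_leq_card/subsetP => x.
by rewrite in_setU [_ \in side PD b]in_set [_ \in side PE b]in_set => /orP[] /andP[].
Qed.

Lemma mem_side (P : {set 'I_n * 'I_n}) c b : c \in A2 -> (c, b) \in P -> x0 < c < x1 -> c \in side P b.
Proof. by move=> cA cP hc; rewrite in_set in_inner // cA hc. Qed.

(** As the block is a square, a diagonal through an interior point of the left side leaves it
    through the interior of the top side. The next three lemmas are its reflections. *)
Lemma LD_side : #|LD| <= #|side PD y1|.
Proof.
apply: (card_le_rel (R := fun x y => x + y == x0 + y1)) => [y|x y y' /eqP E1 /eqP E2]; last first.
  by apply: val_inj => /=; lia.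
rewrite in_set inBo => /andP[/andP[yB hy] h]; have sq := square; have X01 := x01.
have [c [d [cP cA dB [E|E] E2]]] := innerD h (m2 _ _); have [_ _ hd] := inB2 dB.
  by subst; exfalso; arith.
by subst; exists c; [apply: mem_side cA cP _|]; arith.
Qed.

Lemma RE_side : #|RE| <= #|side PE y1|.
Proof.
apply: (card_le_rel (R := fun x y => x + y1 == x1 + y)) => [y|x y y' /eqP E1 /eqP E2]; last first.
  by apply: val_inj => /=; lia.
rewrite in_set inBo => /andP[/andP[yB hy] h]; have sq := square; have X01 := x01.
have [c [d [cP cA dB [E|E] E2]]] := innerE h (m1 _ _); have [_ _ hd] := inB2 dB.
  by subst; exfalso; arith.
by subst; exists c; [apply: mem_side cA cP _|]; arith.
Qed.

Lemma LE_side : #|LE| <= #|side PE y0|.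
Proof.
apply: (card_le_rel (R := fun x y => x + y0 == x0 + y)) => [y|x y y' /eqP E1 /eqP E2]; last first.
  by apply: val_inj => /=; lia.
rewrite in_set inBo => /andP[/andP[yB hy] h]; have sq := square; have X01 := x01.
have [c [d [cP cA dB [E|E] E2]]] := innerE h (m2 _ _); have [_ _ hd] := inB2 dB.
  by subst; exfalso; arith.
by subst; exists c; [apply: mem_side cA cP _|]; arith.
Qed.

Lemma RD_side : #|RD| <= #|side PD y0|.
Proof.
apply: (card_le_rel (R := fun x y => x + y == x1 + y0)) => [y|x y y' /eqP E1 /eqP E2]; last first.
  by apply: val_inj => /=; lia.
rewrite in_set inBo => /andP[/andP[yB hy] h]; have sq := square; have X01 := x01.
have [c [d [cP cA dB [E|E] E2]]] := innerD h (m1 _ _); have [_ _ hd] := inB2 dB.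
  by subst; exfalso; arith.
by subst; exists c; [apply: mem_side cA cP _|]; arith.
Qed.

(* Otherwise LD = RE and LE = RD, so that the bounds on the horizontal sides force
   p - 1 = 2 #|LD|. *)
Lemma common_side : exists2 y, y \in Bo &
  (x0, y) \in PD /\ (x1, y) \in PD \/ (x0, y) \in PE /\ (x1, y) \in PE.
Proof.
have [/existsP[y /andP[yB /orP[/andP[]|/andP[]]]]|] := boolP [exists y, (y \in Bo) &&
  ((((x0, y) \in PD) && ((x1, y) \in PD)) || (((x0, y) \in PE) && ((x1, y) \in PE)))].
- by exists y => //; left.
- by exists y => //; right.
rewrite negb_exists => /forallP none; exfalso.
have cases y : y \in Bo -> ((x0, y) \in PD) = ((x1, y) \in PE) /\ ((x0, y) \in PE) = ((x1, y) \in PD).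
  move=> yBo; have /andP[yB _] : (y \in B2) && (y0 < y < y1) by rewrite -inBo.
  have := none y; rewrite yBo /=; have := inP x0A yB; have := inP x1A yB; rewrite !in_setU.
  by case: (_ \in PD); case: (_ \in PE); case: (_ \in PD); case: (_ \in PE).
have E1 : #|LD| = #|RE|.
  by apply: eq_card => y; rewrite in_set [RHS]in_set; case yB: (y \in Bo) => //=; case: (cases y yB).
have E2 : #|LE| = #|RD|.
  by apply: eq_card => y; rewrite in_set [RHS]in_set; case yB: (y \in Bo) => //=; case: (cases y yB).
have c1 := side_card y1B; have c2 := side_card y0B.
rewrite eqxx orbT in c1; rewrite eqxx in c2.
have {}c1 := c1 isT; have {}c2 := c2 isT.
have s1 := LD_side; have s2 := RE_side; have s3 := LE_side; have s4 := RD_side.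
have : p.-1 <= #|LD| + #|LE|.
  have -> : p.-1 = #|Bo| by rewrite card_inner ?cB2 //; lia.
  rewrite -cardsUI; apply: leq_trans (leq_addr _ _); apply/subset_leq_card/subsetP => y yBo.
  have /andP[yB _] : (y \in B2) && (y0 < y < y1) by rewrite -inBo.
  by rewrite in_setU [_ \in LD]in_set [_ \in LE]in_set yBo; have [->|->] := inPDE x0A yB; rewrite ?orbT.
move: E1 E2 c1 c2 s1 s2 s3 s4 p_even p_gt1; clear.
move: #|LD| #|LE| #|RD| #|RE| #|side PD y1| #|side PE y1| #|side PD y0| #|side PE y0|.
by move=> *; lia.
Qed.

Lemma card_around (y : 'I_n) : y \in B2 ->
  #|[set z : 'I_n in B2 | z < y]| + #|[set z : 'I_n in B2 | y < z]| <= p.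
Proof.
move=> yB; rewrite -cardsUI; set X := _ :&: _; have -> : X = set0.
  by apply/setP => z; rewrite in_setI in_set [X in _ && X]in_set in_set0; apply/negP => /andP[/andP[_ ?] /andP[_ ?]]; arith.
rewrite cards0 addn0; have := cardsD1 y B2; rewrite yB cB2 add1n => -[->].
apply/subset_leq_card/subsetP => z.
rewrite in_setU in_set [X in _ || X]in_set in_setD1 ord_eqE.
by case/orP => /andP[-> ?]; rewrite andbT; arith.
Qed.

(** Take the common [y] on diagonals. By convexity all points of the left side between [y0] and [y]
    are on selected diagonals, so [y] descends to [y0] by steps [u]; likewise the right side leads
    up to [y1]. The steps reach distinct elements of [B2] other than [y], so there are at most [p].
    Antidiagonals exchange the sides. *)
Lemma tight_square_gap : exists2 u, gap u & y1 - y0 <= p * u.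
Proof.
have [u gu] := gap_exists; exists u => //; have [u0 _ _ _ _] := gu.
have [c00 c11 c01 c10] := corners.
have [y yBo hy] := common_side; have := yBo; rewrite inBo => /andP[yB byy].
have lb z : z \in B2 -> y0 <= z by move=> /inB2[_ _ /andP[]].
have ub z : z \in B2 -> z <= y1 by move=> /inB2[_ _ /andP[]].
have [d1 d2] : y <= y0 + u * #|[set z : 'I_n in B2 | z < y]| /\
    y1 <= y + u * #|[set z : 'I_n in B2 | y < z]|.
  case: hy => [] [hL hR]; split.
  - apply: descend => // z zB hz; apply: (left_down gu zB); first by arith.
    by apply: convexD hL c00 _ _ _; rewrite ?inP ?x0A //=; arith.
  - apply: ascend => // z zB hz; apply: (right_up gu zB); first by arith.
    by apply: convexD c11 hR _ _ _; rewrite ?inP ?x1A //=; arith.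
  - apply: descend => // z zB hz; apply: (right_down gu zB); first by arith.
    by apply: convexE c10 hR _ _ _; rewrite ?inP ?x1A //=; arith.
  - apply: ascend => // z zB hz; apply: (left_up gu zB); first by arith.
    by apply: convexE hL c01 _ _ _; rewrite ?inP ?x0A //=; arith.
have := card_around yB; move: d1 d2; move: #|_| #|_| => a b; clear; nia.
Qed.

End TightSquare.

(** * Selecting lines *)

(** Each added line shares at most one square with every other line, so fewer than [size L] squares
    are lost per line. *)
Lemma union_bound (T : finType) (L : seq {set T}) :
  pairwise (fun l l' : {set T} => #|l :&: l'| <= 1) L ->
  \sum_(l <- L) #|l| <= #|\bigcup_(l <- L) l| + size L ^ 2.
Proof.
elim: L => [|l L IH]; first by rewrite !big_nil.
rewrite pairwise_cons => /andP[/allP hl /IH{IH} IH]; rewrite !big_cons cardsU.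
have : #|l :&: \bigcup_(l' <- L) l'| <= size L.
  elim: L hl {IH} => [|l' L IH] hl; first by rewrite big_nil setI0 cards0.
  rewrite big_cons setIUr /=.
  apply: leq_trans (leq_card_setU _ _).1 _; rewrite -add1n; apply: leq_add.
    by apply: hl; rewrite mem_head.
  by apply: IH => x xL; apply: hl; rewrite inE xL orbT.
have : #|l :&: \bigcup_(l' <- L) l'| <= #|l| := subset_leq_card (subsetIl _ _).
rewrite /= !expnS !expn0 !muln1; move: IH; rewrite !expnS !expn0 !muln1.
by move: #|_| #|_| #|_| (\sum_(_ <- _) _) => a b c d; nia.
Qed.

Lemma subset_of_card (T : finType) (S : {set T}) k : k <= #|S| ->
  exists2 S' : {set T}, S' \subset S & #|S'| = k.
Proof.
move=> kS; exists [set x in take k (enum S)].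
  by apply/subsetP => x; rewrite inE => /mem_take; rewrite mem_enum.
rewrite cardsE; have /card_uniqP -> : uniq (take k (enum S)) by rewrite take_uniq ?enum_uniq.
by rewrite size_takel // -cardE.
Qed.

(** Delete a shortest element until at most [r] are left; the result serves all thresholds at once.
    If a deleted element is above [t], then so are all the others, and at least [r] of them
    remain. *)
Lemma largest_elements (T : finType) (len : T -> nat) (S : {set T}) r :
  exists S' : {set T}, [/\ S' \subset S, #|S'| <= r &
    forall t, minn r #|[set l in S | t < len l]| <= #|[set l in S' | t < len l]|].
Proof.
have [k] := ubnP #|S|; elim: k S => // k IH S Sk.
have [Sr|Sr] := leqP #|S| r; first by exists S; split=> // t; exact: geq_minr.
have [l0 l0S] : exists l0, l0 \in S by apply/card_gt0P; lia.
have [l lS' lmin] := arg_minnP len l0S; have {lS'}lS : l \in S := lS'.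
have cS := cardsD1 l S; rewrite lS in cS.
have [|S' [sub cS' h]] := IH (S :\ l); first by lia.
exists S'; split=> [|//|t]; first exact: subset_trans sub (subD1set _ _).
apply: leq_trans (h t).
have [tl|tl] := ltnP t (len l).
  have -> : [set l' in S :\ l | t < len l'] = S :\ l.
    apply/setP => l'; rewrite !inE; case: (l' == l) => //=; case lS' : (l' \in S) => //=.
    by rewrite (leq_trans tl) // lmin.
  by rewrite leq_min geq_minl /=; apply: leq_trans (geq_minl _ _) _; lia.
rewrite leq_min geq_minl /=; apply: leq_trans (geq_minr _ _) _.
apply/subset_leq_card/subsetP => l'; rewrite !inE => /andP[-> tl'].
by rewrite tl' !andbT; apply: contraTneq tl' => ->; rewrite -leqNgt.
Qed.

(** Layer-cake summation: [l] is counted once for every [t] below both [N] and [len l]. *)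
Lemma sum_layers (T : finType) (len : T -> nat) (S : {set T}) N :
  \sum_(t < N) #|[set l in S | t < len l]| <= \sum_(l in S) len l.
Proof.
have E t : #|[set l in S | t < len l]| = \sum_(l in S | t < len l) 1.
  by rewrite -sum1_card; apply: eq_bigl => l; rewrite inE.
rewrite (eq_bigr _ (fun (t : 'I_N) _ => E t)).
have -> : \sum_(t < N) \sum_(l in S | t < len l) 1 = \sum_(l in S) \sum_(t < N | t < len l) 1.
  by rewrite (exchange_big_dep (mem S)) //= => [|t l _ /andP[]//]; apply: eq_bigr => l lS; apply: eq_bigl => t; rewrite lS.
apply: leq_sum => l _; rewrite sum1_card -[leqRHS]card_ord.
have [H|H] := leqP N (len l).
  by apply: leq_trans (max_card _) _; rewrite !card_ord.
pose f (t : 'I_(len l)) : 'I_N := widen_ord (ltnW H) t.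
rewrite -(card_codom (f := f)); last by move=> x y /(congr1 val) /= Exy; apply: val_inj.
apply/subset_leq_card/subsetP => t; rewrite unfold_in => tl.
by apply/codomP; exists (Ordinal tl); apply: val_inj.
Qed.

Lemma bigcup_seq_subset (T : finType) (L : seq {set T}) (U : {set T}) :
  {in L, forall l : {set T}, l \subset U} -> \bigcup_(l <- L) l \subset U.
Proof.
elim: L => [|l L IH] h; first by rewrite big_nil sub0set.
rewrite big_cons subUset h ?mem_head //=; apply: IH => l' l'L; apply: h.
by rewrite inE l'L orbT.
Qed.

Section Cover.
Variable n : nat.
Implicit Types Q : {set 'I_n * 'I_n}.

(** All listed lines are attacked. Distinct parallel lines are disjoint, and lines of different
    directions meet at most once, so [union_bound] applies. *)
Lemma lines_attacked Q (R C : {set 'I_n}) (sD sE : seq {set 'I_n * 'I_n}) :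
  R \subset [set p.1 | p in Q] -> C \subset [set p.2 | p in Q] ->
  uniq sD -> {subset sD <= @diag n @: Q} -> uniq sE -> {subset sE <= @anti n @: Q} ->
  n * #|R| + n * #|C| + \sum_(l <- sD) #|l| + \sum_(l <- sE) #|l| <=
    #|attacked Q| + (#|R| + #|C| + size sD + size sE) ^ 2.
Proof.
move=> /subsetP hR /subsetP hC uD hD uE hE.
pose L := [seq @row n x | x <- enum R] ++ [seq @column n y | y <- enum C] ++ sD ++ sE.
have -> : n * #|R| + n * #|C| + \sum_(l <- sD) #|l| + \sum_(l <- sE) #|l| = \sum_(l <- L) #|l|.
  have E (S : {set 'I_n}) (f : 'I_n -> {set 'I_n * 'I_n}) : (forall x, #|f x| = n) ->
      \sum_(l <- [seq f x | x <- enum S]) #|l| = n * #|S|.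
    by move=> fE; rewrite big_map big_enum (eq_bigr (fun=> n)) //= sum_nat_const mulnC.
  by rewrite /L !big_cat /= !addnA !E // => x; rewrite ?card_row ?card_column.
have -> : #|R| + #|C| + size sD + size sE = size L.
  by rewrite /L !size_cat !size_map -!cardE !addnA.
have le1 (A : {set 'I_n * 'I_n}) :
    (forall p q, p \in A -> q \in A -> p.1 = q.1 :> nat /\ p.2 = q.2 :> nat) -> #|A| <= 1.
  move=> h; apply/card_le1_eqP => -[x y] [x' y'] xA yA.
  by have [/= /val_inj -> /val_inj ->] := h _ _ xA yA.
have att q s : q \in Q -> attacks q s -> s \in attacked Q.
  by move=> qQ h; rewrite inE; apply/existsP; exists q; rewrite qQ.
have LQ : \bigcup_(l <- L) l \subset attacked Q.
  apply: bigcup_seq_subset => l; rewrite !mem_cat => /or4P[].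
  - case/mapP => x; rewrite mem_enum => /hR/imsetP[q qQ ->] ->.
    by apply/subsetP => s; rewrite inE => E; apply: (att q); rewrite // /attacks E.
  - case/mapP => x; rewrite mem_enum => /hC/imsetP[q qQ ->] ->.
    by apply/subsetP => s; rewrite inE => E; apply: (att q); rewrite // /attacks E orbT.
  - move/hD/imsetP => [q qQ ->]; apply/subsetP => s; rewrite inE => E.
    by apply: (att q); rewrite // /attacks E !orbT.
  - move/hE/imsetP => [q qQ ->]; apply/subsetP => s; rewrite inE => E.
    by apply: (att q); rewrite // /attacks E !orbT.
apply: (@leq_trans (#|\bigcup_(l <- L) l| + size L ^ 2)); last by rewrite leq_add2r subset_leq_card.
apply: union_bound.
have parallel (f : 'I_n * 'I_n -> nat) (l l' : {set 'I_n * 'I_n}) a b :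
    l = [set s | f s == a] -> l' = [set s | f s == b] -> l != l' -> #|l :&: l'| <= 1.
  move=> -> -> ll'; suff -> : [set s | f s == a] :&: [set s | f s == b] = set0 by rewrite cards0.
  apply/setP => s; rewrite !inE; apply/negP => /andP[/eqP E1 /eqP E2].
  by move: ll'; rewrite -E1 -E2 eqxx.
have pw (s : seq {set 'I_n * 'I_n}) : uniq s ->
    {in s &, forall l l' : {set 'I_n * 'I_n}, l != l' -> #|l :&: l'| <= 1} ->
    pairwise (fun l l' : {set 'I_n * 'I_n} => #|l :&: l'| <= 1) s.
  rewrite uniq_pairwise => us h; apply: (sub_in_pairwise (P := mem s)) us; last exact/allP.
  by move=> l l' lS l'S; apply: h.
have rowsP l : l \in [seq @row n x | x <- enum R] -> exists x, l = row x.
  by case/mapP => x _ ->; exists x.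
have colsP l : l \in [seq @column n y | y <- enum C] -> exists y, l = column y.
  by case/mapP => x _ ->; exists x.
have sDP l : l \in sD -> exists q, l = diag q by move/hD/imsetP => [q _ ->]; exists q.
have sEP l : l \in sE -> exists q, l = anti q by move/hE/imsetP => [q _ ->]; exists q.
rewrite /L !pairwise_cat !allrel_catr; do ![apply/andP; split].
1-3, 5-6, 8: apply/allrelP => l l'.
- move=> /rowsP[x ->] /colsP[y ->]; apply: le1 => -[a b] [c d]; rewrite !inE /= !ord_eqE; lia.
- move=> /rowsP[x ->] /sDP[[y z] ->]; apply: le1 => -[a b] [c d]; rewrite !inE /= !ord_eqE; lia.
- move=> /rowsP[x ->] /sEP[[y z] ->]; apply: le1 => -[a b] [c d]; rewrite !inE /= !ord_eqE; lia.
- move=> /colsP[x ->] /sDP[[y z] ->]; apply: le1 => -[a b] [c d]; rewrite !inE /= !ord_eqE; lia.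
- move=> /colsP[x ->] /sEP[[y z] ->]; apply: le1 => -[a b] [c d]; rewrite !inE /= !ord_eqE; lia.
- move=> /sDP[[x y] ->] /sEP[[z w] ->]; apply: le1 => -[a b] [c d]; rewrite !inE /=; lia.
- apply: pw => [|l l' /rowsP[x ->] /rowsP[y ->]].
    rewrite map_inj_uniq ?enum_uniq // => x y /setP/(_ (x, x)); rewrite !inE /= eqxx.
    by move/esym/eqP.
  exact: (parallel (fun s => s.1) _ _ x y).
- apply: pw => [|l l' /colsP[x ->] /colsP[y ->]].
    rewrite map_inj_uniq ?enum_uniq // => x y /setP/(_ (x, x)); rewrite !inE /= eqxx.
    by move/esym/eqP.
  exact: (parallel (fun s => s.2) _ _ x y).
- apply: pw => // l l' /sDP[[x y] ->] /sDP[[z w] ->].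
  (* Adding [n] keeps the index of a diagonal free of truncation. *)
  apply: (parallel (fun s => s.1 + n - s.2) _ _ (x + n - y) (z + n - w)); apply/setP => -[a b];
    by rewrite !inE /=; have := ltn_ord b; have := ltn_ord y; have := ltn_ord w; lia.
- apply: pw => // l l' /sEP[[x y] ->] /sEP[[z w] ->].
  exact: (parallel (fun s => s.1 + s.2) _ _ (x + y) (z + w)).
Qed.



End Cover.

(** * Diagonals and antidiagonals above a length threshold *)

Section Threshold.
Variables (n : nat) (Q : {set 'I_n * 'I_n}).

Definition long_diag t := [set q in Q | t < #|diag q|].
Definition long_anti t := [set q in Q | n - t < #|anti q|].

Lemma long_cover t : t < n -> long_diag t :|: long_anti t = Q.
Proof.
move=> tn; apply/setP => q; rewrite !in_set; case: (q \in Q) => //=.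
by have := diag_anti_len q; rewrite card_diag card_anti; lia.
Qed.

Definition line_count t := #|@diag n @: long_diag t| + #|@anti n @: long_anti t|.

(** The length of a diagonal decreases with the absolute value of its offset, so the offsets of long
    diagonals form an interval. *)
Lemma long_diag_convex t (q r s : 'I_n * 'I_n) :
  q \in long_diag t -> r \in long_diag t -> s \in Q ->
  q.1 + s.2 <= s.1 + q.2 -> s.1 + r.2 <= r.1 + s.2 -> s \in long_diag t.
Proof.
rewrite !in_set !card_diag /diag_len => /andP[_ h1] /andP[_ h2] -> /=.
by case: q r s h1 h2 => [? ?] [? ?] [? ?] /=; lia.
Qed.

Lemma long_anti_convex t (q r s : 'I_n * 'I_n) :
  q \in long_anti t -> r \in long_anti t -> s \in Q ->
  q.1 + q.2 <= s.1 + s.2 -> s.1 + s.2 <= r.1 + r.2 -> s \in long_anti t.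
Proof.
rewrite !in_set !card_anti /anti_len => /andP[_ h1] /andP[_ h2] -> /=.
by case: q r s h1 h2 => [? ?] [? ?] [? ?] /=; lia.
Qed.

(** Take the [r] longest lines of each direction. For every [t] at least [r] of them are diagonals
    longer than [t] or antidiagonals longer than [n - t]; summing over [t] gives the total
    length. *)
Lemma select_lines r : (forall t, t < n -> r <= line_count t) ->
  exists sD sE : {set {set 'I_n * 'I_n}},
    [/\ sD \subset @diag n @: Q /\ #|sD| <= r, sE \subset @anti n @: Q /\ #|sE| <= r &
        r * n <= \sum_(l in sD) #|l| + \sum_(l in sE) #|l|].
Proof.
move=> hr.
have [sD [subD cD hD]] := largest_elements (fun l : {set 'I_n * 'I_n} => #|l|) (@diag n @: Q) r.
have [sE [subE cE hE]] := largest_elements (fun l : {set 'I_n * 'I_n} => #|l|) (@anti n @: Q) r.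
exists sD, sE; split=> //.
have lD : \sum_(t < n) #|[set l in sD | t < #|l|]| <= \sum_(l in sD) #|l| := sum_layers _ _ _.
have lE : \sum_(t < n) #|[set l in sE | t < #|l|]| <= \sum_(l in sE) #|l| := sum_layers _ _ _.
apply: leq_trans (leq_add lD lE).
(* Reversal pairs layer [t] of the diagonals with layer [n - 1 - t] of the antidiagonals, which
   contains all those longer than [n - t]. *)
rewrite [X in _ <= _ + X](reindex_inj rev_ord_inj) /= -big_split /=.
rewrite mulnC -[n in n * r](card_ord n) -sum_nat_const; apply: leq_sum => t _.
apply: (@leq_trans (minn r #|@diag n @: long_diag t| + minn r #|@anti n @: long_anti t|)).
  by have := hr t (ltn_ord t); rewrite /line_count; lia.
apply: leq_add.
  apply: leq_trans (hD t); rewrite leq_min geq_minl /=; apply: leq_trans (geq_minr _ _) _.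
  apply/subset_leq_card/subsetP => l /imsetP[q]; rewrite [q \in _]in_set => /andP[qQ ql] ->.
  by rewrite in_set ql imset_f.
apply: leq_trans (hE _); rewrite leq_min geq_minl /=; apply: leq_trans (geq_minr _ _) _.
apply/subset_leq_card/subsetP => l /imsetP[q]; rewrite [q \in _]in_set => /andP[qQ ql] ->.
by rewrite in_set imset_f //=; apply: leq_ltn_trans ql; lia.
Qed.

End Threshold.

(* The diagonals through the left and right sides have offsets summing to at most
   [(p + 1) W] from the central one, whose own offset is limited by the outer frame. *)
Lemma square_lines n (Q : {set 'I_n * 'I_n}) (A B : {set 'I_n}) (x0 x1 y0 y1 : 'I_n) p u :
  spans A x0 x1 -> spans B y0 y1 -> x0 < x1 -> block A B \subset Q -> #|B| = p.+1 ->
  x1 - x0 = y1 - y0 -> y1 - y0 <= p * u ->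
  u <= x0 -> u <= y0 -> x1 + u < n -> y1 + u < n ->
  exists sD sE : seq {set 'I_n * 'I_n},
    [/\ [/\ uniq sD, {subset sD <= @diag n @: Q} & size sD = 2 * p + 1],
        [/\ uniq sE, {subset sE <= @anti n @: Q} & size sE = 2 * p + 1] &
        (2 * p + 1) * n <= \sum_(l <- sD) #|l| + \sum_(l <- sE) #|l|].
Proof.
move=> sA sB x01 /subsetP sub cB sq Wu ux uy xu yu.
have [x0A x1A _] := sA; have [y0B y1B yb] := sB.
have inQ a b : a \in A -> b \in B -> (a, b) \in Q by move=> aA bB; apply: sub; rewrite inE aA.
(* In a square the diagonals through [(x0, y0)] and [(x1, y1)] agree, as do the antidiagonals
   through [(x0, y1)] and [(x1, y0)]. Leaving out [z] removes this one repetition from [2 (p + 1)]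
   lines. *)
pose side (f : 'I_n * 'I_n -> {set 'I_n * 'I_n}) z :=
  [seq f (x0, y) | y <- enum B] ++ [seq f (x1, y) | y <- enum (B :\ z)].
have sizeE f z : z \in B -> size (side f z) = 2 * p + 1.
  move=> zB; rewrite size_cat !size_map -!cardE; have := cardsD1 z B.
  by rewrite zB cB; move: #|_| => c; lia.
have sumE f z : z \in B -> \sum_(l <- side f z) #|l| + #|f (x1, z)| =
    \sum_(y in B) (#|f (x0, y)| + #|f (x1, y)|).
  move=> zB; rewrite /side big_cat !big_map !big_enum big_split /= -addnA.
  by congr (_ + _); rewrite [RHS](big_setD1 z zB) /= addnC.
have subE f z : {subset side f z <= f @: Q}.
  move=> l; rewrite mem_cat => /orP[] /mapP[y]; rewrite mem_enum.
    by move=> yB ->; exact: imset_f (inQ _ _ x0A yB).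
  by rewrite in_setD1 => /andP[_ yB] ->; exact: imset_f (inQ _ _ x1A yB).
exists (side (@diag n) y1), (side (@anti n) y0); split; [split=> //|split=> //|]; auto.
- rewrite cat_uniq !map_inj_uniq ?enum_uniq //=; first last.
  + by move=> y y' /eqP; rewrite diag_eq /= => /eqP E; apply: val_inj => /=; lia.
  + by move=> y y' /eqP; rewrite diag_eq /= => /eqP E; apply: val_inj => /=; lia.
  rewrite andbT; apply/hasPn => l /mapP[y]; rewrite mem_enum in_setD1 ord_eqE => /andP[yy1 yB] ->.
  apply/mapP => -[y']; rewrite mem_enum => y'B /eqP; rewrite diag_eq /= => /eqP E.
  by have := yb y yB; have := yb y' y'B; lia.
- rewrite cat_uniq !map_inj_uniq ?enum_uniq //=; first last.
  + by move=> y y' /eqP; rewrite anti_eq /= => /eqP E; apply: val_inj => /=; lia.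
  + by move=> y y' /eqP; rewrite anti_eq /= => /eqP E; apply: val_inj => /=; lia.
  rewrite andbT; apply/hasPn => l /mapP[y]; rewrite mem_enum in_setD1 ord_eqE => /andP[yy1 yB] ->.
  apply/mapP => -[y']; rewrite mem_enum => y'B /eqP; rewrite anti_eq /= => /eqP E.
  by have := yb y yB; have := yb y' y'B; lia.
have sD := sumE (@diag n) y1 y1B; have sE := sumE (@anti n) y0 y0B; clear sumE subE sizeE.
(* Absolute offsets of the main diagonal and antidiagonal of the square; [ds] says that the square
   enlarged by [u] on all sides fits on the board. *)
pose d0 := (x0 - y0) + (y0 - x0); pose s0 := (x0 + y1 + 1 - n) + (n - (x0 + y1 + 1)).
have ds : d0 + s0 + (y1 - y0) + 2 * u + 1 <= n by rewrite /d0 /s0; lia.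
have lower (f : 'I_n -> nat) c : (forall y, y \in B -> 2 * n <= f y + c) ->
    p.+1 * (2 * n) <= \sum_(y in B) f y + p.+1 * c.
  move=> h; rewrite -cB -!sum_nat_const -big_split /=; exact: leq_sum.
(* Relative to the main diagonal, the two diagonals at height [y] are shifted by [y - y0] and
   [y1 - y], together [y1 - y0]. *)
have := lower (fun y => #|diag (x0, y)| + #|diag (x1, y)|) (2 * d0 + (y1 - y0)).
have := lower (fun y => #|anti (x0, y)| + #|anti (x1, y)|) (2 * s0 + (y1 - y0)).
rewrite -sD -sE.
have -> : #|diag (x1, y1)| = n - d0 by rewrite card_diag /diag_len /d0 /=; lia.
have -> : #|anti (x1, y0)| = n - s0 by rewrite card_anti /anti_len /s0 /=; lia.
move=> h1 h2.
have {}h1 := h1 _; have {}h1 : p.+1 * (2 * n) <= \sum_(l <- side (@anti n) y0) #|l| + (n - s0) + p.+1 * (2 * s0 + (y1 - y0)).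
  apply: h1 => y yB; rewrite !card_anti /anti_len /s0 /=; have := yb y yB; lia.
have {}h2 : p.+1 * (2 * n) <= \sum_(l <- side (@diag n) y1) #|l| + (n - d0) + p.+1 * (2 * d0 + (y1 - y0)).
  apply: h2 => y yB; rewrite !card_diag /diag_len /d0 /=; have := yb y yB; lia.
move: h1 h2 Wu ds; clear.
move: (\sum_(_ <- _) _) (\sum_(_ <- _) _) d0 s0 (y1 - y0) => SE SD d s W h1 h2 Wu ds.
(* The loss from the shifts is [2 (p + 1) W], one [W] more than [ds] pays for directly; [W <= p u]
   is covered by its term [2 u]. *)
have : (2 * p + 1) * (d + s + W + 2 * u + 1) <= (2 * p + 1) * n by rewrite leq_mul2l ds orbT.
lia.
Qed.

(** * The lower bound *)

Section LowerBound.
Variables (n : nat) (Q : {set 'I_n * 'I_n}).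
Let A : {set 'I_n} := [set p.1 | p in Q].
Let B : {set 'I_n} := [set p.2 | p in Q].

Lemma queens_block : Q \subset block A B.
Proof. by apply/subsetP => q qQ; rewrite in_set !imset_f. Qed.

Lemma peel_queens t T : t < n -> 2 * T <= #|A| -> 2 * T <= #|B| ->
  exists A' B' : {set 'I_n}, [/\ #|A'| = #|A| - 2 * T, #|B'| = #|B| - 2 * T &
   #|Q| <= 2 * line_count Q t * T + #|Q :&: block A' B'|].
Proof.
move=> tn hA hB; have := peel (long_diag Q t) (long_anti Q t) hA hB.
by rewrite long_cover // (setIidPl queens_block).
Qed.

Lemma full_of_card (P : {set 'I_n * 'I_n}) (A' B' : {set 'I_n}) :
  #|A'| * #|B'| <= #|P :&: block A' B'| -> block A' B' \subset P.
Proof.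
rewrite -card_block => h; apply/setIidPr/eqP.
by rewrite eqEcard subsetIr.
Qed.

(** Equality in the frame bound forces the block left after [q] frames to be full, and
    [full_block_square] applies to it. *)
Lemma exceptional_not_oblong t q : t < n -> #|A| + #|B| = line_count Q t + 2 + 4 * q ->
  2 * q + 1 < #|A| -> 2 * q + 1 < #|B| -> #|A| <= #|B| + 1 -> #|B| <= #|A| + 1 ->
  #|Q| = 2 * line_count Q t * q + (#|A| - 2 * q) * (#|B| - 2 * q) -> #|A| = #|B|.
Proof.
move=> tn hAB a1 b1 ab ba kE.
have [||A' [B' [cA cB]]] := @peel_queens t q tn; [lia|lia|].
rewrite kE -cA -cB leq_add2l => /full_of_card sub.
have A2 : 1 < #|A'| by lia.
have B2 : 1 < #|B'| by lia.
have [x0 [x1 sA]] := spans_exists (ltnW A2).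
have [y0 [y1 sB]] := spans_exists (ltnW B2).
rewrite -{1}(long_cover Q tn) in sub.
have := full_block_square A2 B2 sA sB sub; rewrite -/(line_count Q t).
by case; lia.
Qed.

(** Only [q - 1] frames are peeled: equality makes the next frame tight and the block inside it
    full. [tight_square_gap] then gives [square_lines] its gap. *)
Lemma exceptional_square t q p : t < n -> 0 < q -> #|A| = p.+1 + 2 * q -> #|B| = p.+1 + 2 * q ->
  ~~ odd p -> 1 < p -> line_count Q t = 2 * p ->
  #|Q| = 2 * line_count Q t * q + (#|A| - 2 * q) * (#|B| - 2 * q) ->
  exists sD sE : seq {set 'I_n * 'I_n},
    [/\ [/\ uniq sD, {subset sD <= @diag n @: Q} & size sD = 2 * p + 1],
        [/\ uniq sE, {subset sE <= @anti n @: Q} & size sE = 2 * p + 1] &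
        (2 * p + 1) * n <= \sum_(l <- sD) #|l| + \sum_(l <- sE) #|l|].
Proof.
move=> tn q0 aE bE pe p1 eE kE.
have [||A1 [B1 [cA cB hQ]]] := @peel_queens t q.-1 tn; [lia|lia|].
have A2 : 1 < #|A1| by lia.
have B2 : 1 < #|B1| by lia.
have [x0' [x1' sA1]] := spans_exists (ltnW A2).
have [y0' [y1' sB1]] := spans_exists (ltnW B2).
have cA2 : #|inner A1 x0' x1'| = p.+1 by rewrite card_inner //; lia.
have cB2 : #|inner B1 y0' y1'| = p.+1 by rewrite card_inner //; lia.
have [|x0 [x1 sA2]] := @spans_exists n (inner A1 x0' x1'); first by rewrite cA2.
have [|y0 [y1 sB2]] := @spans_exists n (inner B1 y0' y1'); first by rewrite cB2.
have hf := frame_le (long_diag Q t) (long_anti Q t) sA1 sB1.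
rewrite long_cover // -/(line_count Q t) in hf.
have hb : #|Q :&: block (inner A1 x0' x1') (inner B1 y0' y1')| <= p.+1 * p.+1.
  by rewrite -{1}cA2 -cB2 -card_block; apply/subset_leq_card/subsetIr.
rewrite (block_split_card A1 B1 x0' x1' y0' y1') kE aE bE !addnK in hQ.
have [tight fullc] : 2 * line_count Q t <= #|Q :&: frame A1 B1 x0' x1' y0' y1'| /\
    p.+1 * p.+1 <= #|Q :&: block (inner A1 x0' x1') (inner B1 y0' y1')|.
  move: hQ hf hb q0; clear; move: #|_ :&: frame _ _ _ _ _ _| #|_ :&: block _ _| (line_count Q t) => f b e.
  by case: q => [|q] /=; rewrite ?ltnn //; lia.
have full : block (inner A1 x0' x1') (inner B1 y0' y1') \subset Q.
  by apply: full_of_card; rewrite cA2 cB2.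
have [u [u0 g1 g2 g3 g4] Wu] : exists2 u, gap x0' x1' y0' y1' x0 x1 y0 y1 u & y1 - y0 <= p * u.
  apply: (@tight_square_gap n (long_diag Q t) (long_anti Q t) A1 B1) => //.
  - by rewrite long_cover.
  - by rewrite long_cover.
  - by move=> a b s ha hb' hs; rewrite long_cover // in hs; apply: long_diag_convex.
  - by move=> a b s ha hb' hs; rewrite long_cover // in hs; apply: long_anti_convex.
have sq : x1 - x0 = y1 - y0.
  rewrite -(long_cover Q tn) in full.
  have := full_block_square _ _ sA2 sB2 full; rewrite -/(line_count Q t) cA2 cB2.
  by case=> //; lia.
apply: (square_lines (u := u) sA2 sB2) => //.
- by apply: spans_lt sA2; rewrite cA2; lia.
- by rewrite -g1 leq_addl.
- by rewrite -g2 leq_addl.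
- by rewrite g3.
- by rewrite g4.
Qed.

(** If every threshold has enough lines, [select_lines] suffices. Otherwise some [a + b + e] is
    below [m], hence [G (a + b + e) < k] and the triple is exceptional. *)
Lemma lower_lines m k : #|Q| = k -> 0 < k -> #|A| + #|B| < m ->
  (forall m', 0 < m' -> k <= G m' -> m <= m') ->
  exists sD sE : seq {set 'I_n * 'I_n},
    [/\ [/\ uniq sD, {subset sD <= @diag n @: Q} & size sD <= m],
        [/\ uniq sE, {subset sE <= @anti n @: Q} & size sE <= m] &
        (m - (#|A| + #|B|)) * n <= \sum_(l <- sD) #|l| + \sum_(l <- sE) #|l|].
Proof.
move=> cQ k0 abm min_m.
have [/forallP all_t|] := boolP [forall t : 'I_n, m - (#|A| + #|B|) <= line_count Q t].
  have [|sD [sE [[subD cD] [subE cE] h]]] := @select_lines n Q (m - (#|A| + #|B|)).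
    by move=> t tn; apply: (all_t (Ordinal tn)).
  exists (enum sD), (enum sE); rewrite !enum_uniq -!cardE; split; [split=> //|split=> //|].
  - by move=> l; rewrite mem_enum => /(subsetP subD).
  - exact: leq_trans cD (leq_subr _ _).
  - by move=> l; rewrite mem_enum => /(subsetP subE).
  - exact: leq_trans cE (leq_subr _ _).
  by rewrite !big_enum.
rewrite negb_forall => /existsP[t]; rewrite -ltnNge => ht.
have tn := ltn_ord t; set e := line_count Q t in ht *.
have [bl1 bl2 bl3] : [/\ k <= #|A| * #|B|, k <= #|A| * e & k <= #|B| * e].
  have := @block_le n (long_diag Q t) (long_anti Q t) A B; rewrite long_cover // cQ.
  by apply; exact: queens_block.
have hT T : 2 * T <= #|A| -> 2 * T <= #|B| ->
    k <= 2 * e * T + (#|A| - 2 * T) * (#|B| - 2 * T).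
  move=> h1 h2; have [A' [B' [cA cB h]]] := @peel_queens t T tn h1 h2.
  rewrite -cQ; apply: (leq_trans h); rewrite leq_add2l -cA -cB -card_block.
  exact/subset_leq_card/subsetIr.
have a0 : 0 < #|A| by move: bl1 k0; clear; move: #|A| => a; nia.
have [hG|[q [kE cases]]] := frame_arith k0 bl1 bl2 bl3 hT.
  have s0 : 0 < #|A| + #|B| + e by rewrite -addnA ltn_addr.
  by have := min_m _ s0 hG; lia.
have square p : 0 < q -> #|A| = p.+1 + 2 * q -> #|B| = p.+1 + 2 * q -> ~~ odd p -> 1 < p ->
    e = 2 * p -> k <= G (#|A| + #|B| + e + 1) ->
    exists sD sE : seq {set 'I_n * 'I_n},
    [/\ [/\ uniq sD, {subset sD <= @diag n @: Q} & size sD <= m],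
        [/\ uniq sE, {subset sE <= @anti n @: Q} & size sE <= m] &
        (m - (#|A| + #|B|)) * n <= \sum_(l <- sD) #|l| + \sum_(l <- sE) #|l|].
  move=> q0 aE bE pe p1 eE hG.
  have mle : m <= #|A| + #|B| + e + 1 by apply: min_m hG; rewrite addn1.
  have [|sD [sE [[uD hD cD] [uE hE cE] h]]] := @exceptional_square t q p tn q0 aE bE pe p1 eE.
    by rewrite cQ.
  exists sD, sE; split; [split=> //|split=> //|]; rewrite ?cD ?cE; [lia|lia|].
  by apply: leq_trans h; rewrite leq_mul2r; apply/orP; right; lia.
(* In the first and last families [k <= G (a + b + e + 1)], so the [e + 1] line lengths supplied by
   the square suffice. In the middle two [a + b] is odd, contradicting [a = b]. *)
case: cases => [[q0 aE bE eE]|[q0 abE a1 b1 eE]|[abE a1 b1 eE]|[q0 aE bE eE]].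
- apply: (square (2 * q)); [by []|lia|lia|by rewrite mul2n odd_double|lia|lia|].
  have -> : #|A| + #|B| + e + 1 = 12 * q + 3 by lia.
  rewrite kE aE bE eE GE // (_ : 4 * q + 1 - 2 * q = 2 * q + 1); last by lia.
  by clear; rewrite !expnS !expn0 !muln1 /=; lia.
- suff : #|A| = #|B| by lia.
  by apply: (@exceptional_not_oblong t q); rewrite ?cQ //; rewrite -/e; lia.
- suff : #|A| = #|B| by lia.
  by apply: (@exceptional_not_oblong t q); rewrite ?cQ //; rewrite -/e; lia.
- apply: (square (2 * q + 2)); [by []|lia|lia|by rewrite oddD mul2n odd_double|lia|lia|].
  have -> : #|A| + #|B| + e + 1 = 12 * q + 11 by lia.
  rewrite kE aE bE eE GE // (_ : 4 * q + 3 - 2 * q = 2 * q + 3); last by lia.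
  by clear; rewrite !expnS !expn0 !muln1 /=; lia.
Qed.

(* At most [3 m] lines are used, so overlaps cost at most [(3 m)^2] squares. *)
Lemma attacked_lower m k : #|Q| = k -> 0 < k ->
  (forall m', 0 < m' -> k <= G m' -> m <= m') -> m * n <= #|attacked Q| + 9 * m ^ 2.
Proof.
move=> cQ k0 min_m.
have [abm|abm] := ltnP (#|A| + #|B|) m.
  have [sD [sE [[uD hD cD] [uE hE cE] h]]] := lower_lines cQ k0 abm min_m.
  have := lines_attacked (subxx A) (subxx B) uD hD uE hE.
  move: h abm cD cE; move: (\sum_(_ <- _) _) (\sum_(_ <- _) _) (size sD) (size sE) => SD SE cD cE.
  move: #|A| #|B| #|attacked Q| => a b att h abm hcD hcE h2.
  have sq : (a + b + cD + cE) ^ 2 <= (3 * m) ^ 2 by rewrite leq_exp2r //; lia.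
  rewrite expnMn in sq; move: sq h2; rewrite -[3 ^ 2]/9.
  move: (_ ^ 2) (m ^ 2) => u v sq h2.
  have -> : m = (m - (a + b)) + (a + b) by lia.
  by rewrite mulnDl; lia.
(* Here [m] of the occupied rows and columns suffice, without any diagonals. *)
have [|R subR cR] := @subset_of_card _ A (minn m #|A|); first exact: geq_minr.
have [|C subC cC] := @subset_of_card _ B (m - minn m #|A|); first by lia.
have h : n * #|R| + n * #|C| <= #|attacked Q| + (#|R| + #|C|) ^ 2.
  by have := @lines_attacked n Q R C [::] [::] subR subC; rewrite !big_nil !addn0; apply.
have cRC : #|R| + #|C| = m by lia.
by rewrite -mulnDr cRC in h; rewrite mulnC; lia.
Qed.

End LowerBound.

(** * Placements attacking few squares *)

Lemma card_le_nat (T : finType) (A : {set T}) (f : T -> nat) L :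
  {in A &, injective f} -> (forall s, s \in A -> f s < L) -> #|A| <= L.
Proof.
move=> inj lt; case: (set_0Vmem A) => [->|[s0 s0A]]; first by rewrite cards0.
case: L lt => [|L] lt; first by have := lt s0 s0A.
rewrite -(card_in_imset (f := fun s => inord (f s) : 'I_L.+1)).
  by rewrite -[leqRHS]card_ord; apply: max_card.
by move=> s t sA tA /(congr1 val) /=; rewrite !inordK ?lt // => /inj; apply.
Qed.

(** On the level [f + g = u] the map [f] is injective with at most [u + 1] values; summing the
    levels gives a triangular number. *)
Lemma card_triangle (T : finType) (A : {set T}) (f g : T -> nat) u :
  {in A &, forall s t, f s = f t -> g s = g t -> s = t} ->
  (forall s, s \in A -> f s + g s < u) -> 2 * #|A| <= u * u.+1.
Proof.
elim: u A => [|u IH] A inj lt.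
  by rewrite (_ : A = set0) ?cards0 //; apply/setP => s; rewrite inE; apply/negP => /lt.
rewrite -(cardsID [set s | f s + g s < u] A).
have h1 : 2 * #|A :&: [set s | f s + g s < u]| <= u * u.+1.
  apply: IH => [s t /setIP[sA _] /setIP[tA _]|s]; first exact: inj.
  by rewrite !inE => /andP[].
have h2 : #|A :\: [set s | f s + g s < u]| <= u.+1.
  apply: (@card_le_nat _ _ f) => [s t|s].
    rewrite !inE -!leqNgt => /andP[h1' sA] /andP[h2 tA] E; apply: inj => //.
    by have := lt s sA; have := lt t tA; lia.
  by rewrite !inE => /andP[_ /lt]; lia.
by rewrite mulnDr; lia.
Qed.

Lemma card_ord_lt n a : a <= n -> #|[set x : 'I_n | x < a]| = a.
Proof.
move=> an; rewrite -[RHS]card_ord -(card_imset predT (f := widen_ord an)).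
  apply: eq_card => x; rewrite inE; apply/idP/imsetP => [xa|[y _ ->]]; last exact: (ltn_ord y).
  by exists (Ordinal xa) => //; apply: val_inj.
by move=> x y /(congr1 val) /= E; apply: val_inj.
Qed.

Section Covering.
Variable n : nat.
Implicit Types Q : {set 'I_n * 'I_n}.

Lemma card_mem_seq (T : finType) (f : T -> nat) (c : nat -> nat) (I : seq nat) :
  (forall i, #|[set s | f s == i]| <= c i) ->
  #|[set s | f s \in I]| <= \sum_(i <- I) c i.
Proof.
move=> h; elim: I => [|i I IH]; first by rewrite big_nil leqn0 cards_eq0; apply/eqP/setP => s; rewrite !inE.
rewrite big_cons (_ : [set s | f s \in i :: I] = [set s | f s == i] :|: [set s | f s \in I]).
  by apply: leq_trans (leq_card_setU _ _).1 _; apply: leq_add.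
by apply/setP => s; rewrite !inE.
Qed.

(** From [x + n - y = i] follow [x < i] and [y < 2 n - i], and either coordinate determines the
    square. *)
Lemma card_diag_index i : #|[set s : 'I_n * 'I_n | s.1 + n - s.2 == i]| <= minn i (2 * n - i).
Proof.
rewrite leq_min; apply/andP; split.
  apply: (@card_le_nat _ _ (fun s : 'I_n * 'I_n => s.1 : nat)) => [[x y] [x' y']|[x y]]; rewrite !inE /= => /eqP E1; last first.
    by have := ltn_ord y; lia.
  move=> /eqP E2 /val_inj E; subst x'; congr pair; apply: val_inj => /=.
  by have := ltn_ord y; have := ltn_ord y'; lia.
apply: (@card_le_nat _ _ (fun s : 'I_n * 'I_n => s.2 : nat)) => [[x y] [x' y']|[x y]]; rewrite !inE /= => /eqP E1; last first.
  by have := ltn_ord x; have := ltn_ord y; lia.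
move=> /eqP E2 /val_inj E; subst y'; congr pair; apply: val_inj => /=.
by have := ltn_ord y; lia.
Qed.

Lemma card_anti_index j : #|[set s : 'I_n * 'I_n | s.1 + s.2 == j]| <= minn j.+1 (2 * n - 1 - j).
Proof.
rewrite leq_min; apply/andP; split.
  apply: (@card_le_nat _ _ (fun s : 'I_n * 'I_n => s.1 : nat)) => [[x y] [x' y']|[x y]]; rewrite !inE /= => /eqP E1; last first.
    by lia.
  by move=> /eqP E2 /val_inj E; subst x'; congr pair; apply: val_inj => /=; lia.
apply: (@card_le_nat _ _ (fun s : 'I_n * 'I_n => n - 1 - s.1 : nat)) => [[x y] [x' y']|[x y]]; rewrite !inE /= => /eqP E1; last first.
  by have := ltn_ord x; have := ltn_ord y; lia.
move=> /eqP E2 E; have := ltn_ord x; have := ltn_ord x' => h1 h2.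
by congr pair; apply: val_inj => /=; lia.
Qed.

Lemma attacked_le Q (R C I J : seq nat) :
  (forall x y : 'I_n, (x, y) \in Q ->
     [/\ val x \in R, val y \in C, x + n - y \in I & x + y \in J]) ->
  #|attacked Q| <= n * size R + n * size C +
    \sum_(i <- I) minn i (2 * n - i) + \sum_(j <- J) minn j.+1 (2 * n - 1 - j).
Proof.
move=> h.
pose A1 := [set s : 'I_n * 'I_n | val s.1 \in R].
pose A2 := [set s : 'I_n * 'I_n | val s.2 \in C].
pose A3 := [set s : 'I_n * 'I_n | s.1 + n - s.2 \in I].
pose A4 := [set s : 'I_n * 'I_n | s.1 + s.2 \in J].
have hr : #|A1| <= n * size R.
  rewrite mulnC -sum1_size big_distrl /=; apply: (card_mem_seq (f := fun s : 'I_n * 'I_n => val s.1)) => i.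
  rewrite mul1n; apply: (@card_le_nat _ _ (fun s : 'I_n * 'I_n => s.2 : nat)) => [[x y] [x' y']|[x y]]; last by [].
  by rewrite !inE /= => /eqP <- /eqP /val_inj -> /val_inj ->.
have hc : #|A2| <= n * size C.
  rewrite mulnC -sum1_size big_distrl /=; apply: (card_mem_seq (f := fun s : 'I_n * 'I_n => val s.2)) => i.
  rewrite mul1n; apply: (@card_le_nat _ _ (fun s : 'I_n * 'I_n => s.1 : nat)) => [[x y] [x' y']|[x y]]; last by [].
  by rewrite !inE /= => /eqP <- /eqP /val_inj -> /val_inj ->.
have hi := card_mem_seq I card_diag_index.
have hj := card_mem_seq J card_anti_index.
apply: leq_trans (leq_add (leq_add (leq_add hr hc) hi) hj).
apply: (@leq_trans #|A1 :|: A2 :|: A3 :|: A4|); last first.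
  apply: leq_trans (leq_card_setU _ _).1 _; rewrite leq_add2r.
  by apply: leq_trans (leq_card_setU _ _).1 _; rewrite leq_add2r (leq_card_setU _ _).1.
apply/subset_leq_card/subsetP => -[x y]; rewrite !inE /= => /existsP[[a b] /andP[/h[hR hC hI hJ]]].
rewrite /attacks /= => /or4P[/eqP E|/eqP E|/eqP E|/eqP E].
- by rewrite E hR.
- by rewrite E hC !orbT.
- by rewrite (_ : x + n - y = a + n - b) ?hI ?orbT //; have := ltn_ord y; have := ltn_ord b; lia.
- by rewrite E hJ !orbT.
Qed.

Lemma sum_iota_le (f : nat -> nat) lo N c :
  (forall i, lo <= i < lo + N -> f i <= c) -> \sum_(i <- iota lo N) f i <= N * c.
Proof.
move=> h; rewrite -[in N * c](size_iota lo N) -sum1_size big_distrl /=.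
rewrite big_seq [leqRHS]big_seq; apply: leq_sum => i; rewrite mem_iota => hi.
by rewrite mul1n h.
Qed.

(** A corner box with triangles of side [u] at [(0, b - 1)] and side [v] at [(a - 1, 0)] cut off;
    this removes [u + v] of its [a + b - 1] diagonals. *)
Definition hexagon (a b u v : nat) : {set 'I_n * 'I_n} :=
  [set q : 'I_n * 'I_n | [&& q.1 < a, q.2 < b, u <= q.1 + (b.-1 - q.2) & v <= a.-1 - q.1 + q.2]].

Lemma card_hexagon a b u v : a <= n -> b <= n ->
  2 * (a * b) <= 2 * #|hexagon a b u v| + u * u.+1 + v * v.+1.
Proof.
move=> an bn; pose box := setX [set x : 'I_n | x < a] [set y : 'I_n | y < b].
have cbox : #|box| = a * b by rewrite cardsX !card_ord_lt.
pose U := [set q : 'I_n * 'I_n in box | q.1 + (b.-1 - q.2) < u].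
pose V := [set q : 'I_n * 'I_n in box | a.-1 - q.1 + q.2 < v].
have hU : 2 * #|U| <= u * u.+1.
  apply: (@card_triangle _ _ (fun q : 'I_n * 'I_n => q.1 : nat) (fun q : 'I_n * 'I_n => b.-1 - q.2 : nat)) => [[x y] [x' y']|[x y]].
    rewrite !inE /= => /andP[/andP[? ?] _] /andP[/andP[? ?] _] /val_inj -> E.
    by congr pair; apply: val_inj => /=; lia.
  by rewrite inE /= => /andP[].
have hV : 2 * #|V| <= v * v.+1.
  apply: (@card_triangle _ _ (fun q : 'I_n * 'I_n => a.-1 - q.1 : nat) (fun q : 'I_n * 'I_n => q.2 : nat)) => [[x y] [x' y']|[x y]].
    rewrite !inE /= => /andP[/andP[? ?] _] /andP[/andP[? ?] _] E /val_inj ->.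
    by congr pair; apply: val_inj => /=; lia.
  by rewrite inE /= => /andP[].
have : #|box| <= #|hexagon a b u v| + #|U| + #|V|.
  apply: (@leq_trans #|hexagon a b u v :|: U :|: V|).
    apply/subset_leq_card/subsetP => -[x y]; rewrite !inE /= => /andP[-> ->] /=.
    by rewrite !(ltnNge _ u) !(ltnNge _ v); case: (u <= _); case: (v <= _).
  by apply: leq_trans (leq_card_setU _ _).1 _; rewrite leq_add2r (leq_card_setU _ _).1.
by rewrite cbox; lia.
Qed.

(** The antidiagonals lie near the corner of the board: fewer than [a + b] indices, each with at
    most [a + b] squares, so they only contribute to the error. *)
Lemma attacked_hexagon a b u v : a <= n -> b <= n -> u + v < a + b ->
  #|attacked (hexagon a b u v)| <= n * (2 * a + 2 * b - 1 - u - v) + (a + b) ^ 2.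
Proof.
move=> an bn uv; apply: leq_trans
  (@attacked_le _ (iota 0 a) (iota 0 b) (iota (n + u + 1 - b) (a + b - 1 - u - v)) (iota 0 (a + b)) _) _.
  move=> x y; rewrite inE /= => /and4P[xa yb hu hv]; rewrite !mem_iota.
  by split; lia.
rewrite !size_iota.
have h1 : \sum_(i <- iota (n + u + 1 - b) (a + b - 1 - u - v)) minn i (2 * n - i) <= (a + b - 1 - u - v) * n.
  by apply: sum_iota_le => i _; lia.
have h2 : \sum_(j <- iota 0 (a + b)) minn j.+1 (2 * n - 1 - j) <= (a + b) * (a + b).
  by apply: sum_iota_le => i /andP[_ hi]; lia.
rewrite (_ : 2 * a + 2 * b - 1 - u - v = a + b + (a + b - 1 - u - v)); last by lia.
by rewrite -mulnn !mulnDr; lia.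
Qed.

(** With [s = 2 h + 1], opposite corners share [s] central diagonals or antidiagonals. With [2 s]
    rows and [2 s] columns this makes [6 s = 12 h + 6] long lines. *)
Lemma fourfold_hexagon h : 2 * (2 * h + 1) <= n ->
  exists Q, 4 * (3 * h ^ 2 + 3 * h + 1) <= #|Q| /\
    #|attacked Q| <= n * (12 * h + 6) + 16 * (2 * h + 1) ^ 2.
Proof.
move=> hn; pose s := 2 * h + 1; pose H := hexagon s s h h.
pose flip (b : bool) (x : 'I_n) := if b then rev_ord x else x.
pose F (q : (bool * bool) * ('I_n * 'I_n)) := (flip q.1.1 q.2.1, flip q.1.2 q.2.2).
exists (F @: setX setT H); split.
  rewrite card_in_imset.
    rewrite cardsX cardsT card_prod card_bool leq_mul2l /=.
    have := @card_hexagon s s h h; rewrite -/H => hH.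
    have {}hH := hH _ _; have {hH} : 2 * (s * s) <= 2 * #|H| + h * h.+1 + h * h.+1 by apply: hH; lia.
    by rewrite /s; move: #|H| => c; rewrite !expnS !expn0; lia.
  move=> [[b c] [x y]] [[b' c'] [x' y']]; rewrite !inE /=.
  move=> /and4P[xs ys _ _] /and4P[xs' ys' _ _] [/(congr1 val) E1 /(congr1 val) E2].
  have [-> ->] : b = b' /\ x = x'.
    move: E1; rewrite /flip; case: b; case: b' => /= E1; split=> //; try (by exfalso; lia).
    - by apply: val_inj => /=; lia.
    - by apply: val_inj.
  have [-> ->] // : c = c' /\ y = y'.
  move: E2; rewrite /flip; case: c; case: c' => /= E2; split=> //; try (by exfalso; lia).
  - by apply: val_inj => /=; lia.
  - by apply: val_inj.
(* In each diagonal direction the first list holds the shared long lines, the other two the short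
   lines near the remaining two corners. *)
apply: leq_trans (@attacked_le _ (iota 0 s ++ iota (n - s) s) (iota 0 s ++ iota (n - s) s)
  (iota (n - h) s ++ (iota 1 (2 * s) ++ iota (2 * n - 2 * s) (2 * s)))
  (iota (n - 1 - h) s ++ (iota 0 (2 * s) ++ iota (2 * n - 1 - 2 * s) (2 * s))) _) _.
  move=> x y /imsetP[[[b c] [x' y']]]; rewrite !inE /=.
  move=> /and4P[xs ys h1 h2] [-> ->]; rewrite !mem_cat !mem_iota.
  have := ltn_ord x'; have := ltn_ord y'.
  by rewrite /flip /s; case: b; case: c => /= n1 n2; split; rewrite /s in xs ys h1 h2; lia.
rewrite !size_cat !size_iota !big_cat /=.
have i1 : \sum_(i <- iota (n - h) s) minn i (2 * n - i) <= s * n.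
  by apply: sum_iota_le => i _; lia.
have i2 : \sum_(i <- iota 1 (2 * s)) minn i (2 * n - i) <= 2 * s * (2 * s).
  by apply: sum_iota_le => i /andP[_ hi]; lia.
have i3 : \sum_(i <- iota (2 * n - 2 * s) (2 * s)) minn i (2 * n - i) <= 2 * s * (2 * s).
  by apply: sum_iota_le => i /andP[hi _]; lia.
have j1 : \sum_(j <- iota (n - 1 - h) s) minn j.+1 (2 * n - 1 - j) <= s * n.
  by apply: sum_iota_le => i _; lia.
have j2 : \sum_(j <- iota 0 (2 * s)) minn j.+1 (2 * n - 1 - j) <= 2 * s * (2 * s).
  by apply: sum_iota_le => i /andP[_ hi]; lia.
have j3 : \sum_(j <- iota (2 * n - 1 - 2 * s) (2 * s)) minn j.+1 (2 * n - 1 - j) <= 2 * s * (2 * s).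
  by apply: sum_iota_le => i /andP[hi _]; lia.
rewrite -/s (_ : 12 * h + 6 = 6 * s); last by rewrite /s; lia.
by move: i1 i2 i3 j1 j2 j3; rewrite -mulnn; clear; lia.
Qed.

(** With spacing about [n / 2], the six rows and columns and the two main diagonals cost [8 n], the
    four half-length diagonals about [2 n], and the corner ones only a constant. *)
Lemma three_by_three : 2 < n ->
  exists Q, #|Q| = 9 /\ #|attacked Q| <= n * 10 + 16.
Proof.
move=> n2; have [s [hs1 hs2]] : exists s, 2 * s < n /\ n <= 2 * s + 2 by exists (n.-1 %/ 2); lia.
have s0 : 0 < s by lia.
have [l0 l1] : 0 < n /\ s < n by lia.
have f1 : minn n (2 * n - n) <= n by apply: leq_trans (geq_minl _ _) _; clear -hs1 hs2; lia.
have f2 : minn (n + s) (2 * n - (n + s)) <= n - s by apply: leq_trans (geq_minr _ _) _; clear -hs1 hs2; lia.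
have f3 : minn (n - s) (2 * n - (n - s)) <= n - s by apply: leq_trans (geq_minl _ _) _; clear -hs1 hs2; lia.
have f4 : minn (n + 2 * s) (2 * n - (n + 2 * s)) <= 2 by apply: leq_trans (geq_minr _ _) _; clear -hs1 hs2; lia.
have f5 : minn (n - 2 * s) (2 * n - (n - 2 * s)) <= 2 by apply: leq_trans (geq_minl _ _) _; clear -hs1 hs2; lia.
have g1 : minn 1 (2 * n - 1 - 0) <= 1 by apply: leq_trans (geq_minl _ _) _; clear -hs1 hs2; lia.
have g2 : minn s.+1 (2 * n - 1 - s) <= s + 1 by apply: leq_trans (geq_minl _ _) _; clear -hs1 hs2; lia.
have g3 : minn (2 * s).+1 (2 * n - 1 - 2 * s) <= n by apply: leq_trans (geq_minl _ _) _; clear -hs1 hs2; lia.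
have g4 : minn (3 * s).+1 (2 * n - 1 - 3 * s) <= 2 * n - 1 - 3 * s by apply: leq_trans (geq_minr _ _) _; clear -hs1 hs2; lia.
have g5 : minn (4 * s).+1 (2 * n - 1 - 4 * s) <= 3 by apply: leq_trans (geq_minr _ _) _; clear -hs1 hs2; lia.
pose S := [set Ordinal l0; Ordinal l1; Ordinal hs1].
have cS : #|S| = 3.
  rewrite /S setUC cardsU1 cards2 !inE !ord_eqE /=; clear -s0.
  by case: eqP; case: eqP; case: eqP => //=; lia.
have inS (x : 'I_n) : x \in S -> [\/ x = 0 :> nat, x = s :> nat | x = 2 * s :> nat].
  rewrite !inE => /orP[/orP[]|] /eqP ->; [exact: Or31|exact: Or32|exact: Or33].
exists (setX S S); split; first by rewrite cardsX cS.
apply: leq_trans (@attacked_le _ [:: 0; s; 2 * s] [:: 0; s; 2 * s]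
  [:: n; n + s; n - s; n + 2 * s; n - 2 * s] [:: 0; s; 2 * s; 3 * s; 4 * s] _) _.
  move=> x y; rewrite in_setX => /andP[/inS hx /inS hy]; rewrite !inE /=.
  by case: hx => ->; case: hy => ->; clear -hs1 hs2; split; lia.
rewrite !big_cons !big_nil /=.
have := hs1; move: f1 f2 f3 f4 f5 g1 g2 g3 g4 g5 hs2; clear.
do 10!move: (minn _ _) => ?; lia.
Qed.

End Covering.

(** Nearly regular hexagons, with [a, b] about [m / 3] and [u, v] about [m / 6], serve all residues
    except 6 mod 12 and the value [m = 10]. *)
Lemma few_attacked (m n k : nat) : 0 < k -> k <= G m -> 0 < m -> 4 * m <= n ->
  exists Q : {set 'I_n * 'I_n}, k <= #|Q| /\ #|attacked Q| <= m * n + 16 * m ^ 2.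
Proof.
move=> k0 kG m0 mn.
have hex a b u v : a <= n -> b <= n -> u + v < a + b ->
    2 * a + 2 * b - 1 - u - v <= m -> a + b <= 4 * m ->
    2 * k + u * u.+1 + v * v.+1 <= 2 * (a * b) ->
    exists Q : {set 'I_n * 'I_n}, k <= #|Q| /\ #|attacked Q| <= m * n + 16 * m ^ 2.
  move=> an bn uv cm abm hk; exists (hexagon n a b u v); split.
    by have := card_hexagon u v an bn; lia.
  apply: leq_trans (attacked_hexagon an bn uv) _; rewrite mulnC; apply: leq_add.
    by rewrite leq_mul2r cm orbT.
  by rewrite -[16]/(4 ^ 2) -expnMn leq_exp2r.
have mE : m = 12 * (m %/ 12) + m %% 12 by rewrite mulnC; exact: divn_eq.
have rlt : m %% 12 < 12 by rewrite ltn_pmod.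
have : m %% 12 \in iota 0 12 by rewrite mem_iota.
move: mE rlt; set q := m %/ 12; move: (m %% 12) => r mE rlt.
rewrite mE GE // in kG; rewrite !expnS !expn0 !muln1 in kG.
rewrite !inE; do 11?[case/orP]; move/eqP => rE; rewrite {}rE /= ?addn0 ?addn1 in kG mE; clear rlt.
- case: (q) mE kG => [|q'] mE kG; first by lia.
  by apply: (hex (4 * q'.+1) (4 * q'.+1) (2 * q'.+1) (2 * q').+1); lia.
- case: (q) mE kG => [|q'] mE kG; first by lia.
  by apply: (hex (4 * q'.+1) (4 * q'.+1) (2 * q').+1 (2 * q').+1); lia.
- by apply: (hex (4 * q + 1) (4 * q + 1) (2 * q) (2 * q + 1)); lia.
- by apply: (hex (4 * q + 1) (4 * q + 1) (2 * q) (2 * q)); lia.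
- case: (q) mE kG => [|q'] mE kG; first by apply: (hex 1 1 0 0); lia.
  by apply: (hex (4 * q'.+1 + 1) (4 * q'.+1 + 1) (2 * q'.+1) (2 * q').+1); lia.
- by apply: (hex (4 * q + 2) (4 * q + 1) (2 * q) (2 * q)); lia.
- have [|Q [cQ aQ]] := @fourfold_hexagon n q; first by lia.
  exists Q; split; first by apply: leq_trans cQ; rewrite !expnS !expn0; lia.
  apply: (leq_trans aQ); rewrite -mE mulnC leq_add2l leq_mul2l /= leq_exp2r //; lia.
- by apply: (hex (4 * q + 2) (4 * q + 2) (2 * q) (2 * q)); lia.
- by apply: (hex (4 * q + 3) (4 * q + 2) (2 * q + 1) (2 * q)); lia.
- by apply: (hex (4 * q + 3) (4 * q + 3) (2 * q + 1) (2 * q + 1)); lia.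
- case: (q) mE kG => [|q'] mE kG.
    have [|Q [cQ aQ]] := @three_by_three n; first by lia.
    exists Q; split; first by rewrite cQ; lia.
    by apply: (leq_trans aQ); rewrite mE; lia.
  by apply: (hex (4 * q'.+1 + 3) (4 * q'.+1 + 3) (2 * q'.+1 + 1) (2 * q'.+1)); lia.
- by apply: (hex (4 * q + 4) (4 * q + 4) (2 * q + 2) (2 * q + 2)); lia.
Qed.

(** * Combining the two bounds *)

Lemma min_attacked_le n k (Q : {set 'I_n * 'I_n}) : #|Q| = k ->
  min_attacked n k <= #|attacked Q|.
Proof.
move=> cQ; rewrite /min_attacked; have : Q \in index_enum {set 'I_n * 'I_n} by exact: mem_index_enum.
elim: (index_enum _) => // Q' s IH; rewrite inE big_cons => /orP[/eqP <-|/IH h].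
  by rewrite cQ eqxx geq_minl.
by case: ifP => // _; apply: leq_trans (geq_minr _ _) h.
Qed.

Lemma attacked_subset n (Q Q' : {set 'I_n * 'I_n}) : Q \subset Q' -> attacked Q \subset attacked Q'.
Proof.
move=> /subsetP sub; apply/subsetP => s; rewrite !inE => /existsP[q /andP[/sub qQ h]].
by apply/existsP; exists q; rewrite qQ.
Qed.

Theorem theorem1 :
  exists C : nat,
    forall k n m : nat,
      (0 < k)%N -> (0 < n)%N -> (k <= n ^ 2)%N ->
      (0 < m)%N -> (k <= G m)%N ->
      (forall m' : nat, (0 < m')%N -> (k <= G m')%N -> (m <= m')%N) ->
      (`|(min_attacked n k)%:Z - (m * n)%:Z|%R <= (C * k)%:Z)%R.
Proof.
(* The larger error is [16 m^2], and [m^2 <= 48 k]; [768 = 16 * 48]. *)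
exists 768 => k n m k0 n0 kn m0 kG min_m.
have mk := G_lower_sq k0 m0 kG min_m.
have lower : m * n <= min_attacked n k + 9 * m ^ 2.
  rewrite /min_attacked; elim/big_ind: _ => [|x y hx hy|Q /eqP cQ].
  (* The starting value [n ^ 2] of the minimum must satisfy the bound too. *)
  - have [mn|nm] := leqP m n; first by rewrite -mulnn -mulnn; nia.
    by rewrite -mulnn -mulnn; nia.
  - by lia.
  - exact: attacked_lower cQ k0 min_m.
have upper : min_attacked n k <= m * n + 16 * m ^ 2.
  have [mn|nm] := leqP (4 * m) n.
    have [Q [cQ aQ]] := few_attacked k0 kG m0 mn.
    have [Q' sub cQ'] := subset_of_card cQ.
    apply: leq_trans (min_attacked_le cQ') _; apply: leq_trans aQ.
    exact/subset_leq_card/attacked_subset.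
  have [|Q' sub cQ'] := @subset_of_card _ [set: 'I_n * 'I_n] k.
    by rewrite cardsT card_prod card_ord mulnn.
  apply: leq_trans (min_attacked_le cQ') _; apply: leq_trans (max_card _) _.
  rewrite card_prod card_ord; apply: leq_trans (leq_addl _ _).
  by rewrite -[16]/(4 ^ 2) -expnMn mulnn leq_exp2r // ltnW.
by move: lower upper mk; move: (min_attacked n k) (m * n) (m ^ 2) => x y z; lia.
Qed.
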